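(* Let $G$ be a finite cyclic group of order $N$, $\mathbf{k}$ a commutative $\mathbb{Q}$-algebra, and $\iota:G\to\mathbb{C}^\times$ a group embedding. There exists a unique topological $\mathbf{k}$-module isomorphism $\mathrm{iso}^{\mathcal M,\iota}:\widehat{\mathcal M}^{\mathrm B}_N\to\widehat{\mathcal M}^{\mathrm{DR}}_G$ such that $$\mathrm{iso}^{\mathcal M,\iota}\circ\widehat{(-\cdot1_{\mathrm B})}=(-\cdot1_{\mathrm{DR}})\circ\mathrm{iso}^{\mathcal V,\iota}$$ as maps $\widehat{\mathcal V}^{\mathrm B}_N\to\widehat{\mathcal M}^{\mathrm{DR}}_G$.
   Context: $\widehat{\mathcal V}^{\mathrm{DR}}_G$ is the complete graded $\mathbf{k}$-algebra generated by $e_0,e_1$ (degree $1$) and the elements of $G$ (degree $0$), with relations: the product of $g,h\in G$ is $gh$, the unit of $G$ is $1$, and $ge_0=e_0g$ for $g\in G$. $\widehat{\mathcal M}^{\mathrm{DR}}_G:=\widehat{\mathcal V}^{\mathrm{DR}}_G/(\widehat{\mathcal V}^{\mathrm{DR}}_Ge_0+\sum_{g\in G}\widehat{\mathcal V}^{\mathrm{DR}}_G(g-1))$ (complete graded), $1_{\mathrm{DR}}$ is the class of $1$, and $-\cdot1_{\mathrm{DR}}:\widehat{\mathcal V}^{\mathrm{DR}}_G\to\widehat{\mathcal M}^{\mathrm{DR}}_G$ is the projection. $F_2$ is the free group on $X_0,X_1$, $\mu_N\subset\mathbb{C}^\times$ is the group of $N$-th roots of unity, $\mathcal V^{\mathrm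 B}_N:=\mathbf{k}F_2$ with filtration $\mathcal F^m\mathcal V^{\mathrm B}_N=\mathcal I^m$ ($\mathcal I^0=\mathbf{k}F_2$), where $\mathcal I$ is the kernel of the algebra morphism $\mathbf{k}F_2\to\mathbf{k}\mu_N$ induced by $X_0\mapsto e^{2\pi i/N}$, $X_1\mapsto1$; $\widehat{\mathcal V}^{\mathrm B}_N:=\varprojlim\mathcal V^{\mathrm B}_N/\mathcal F^m\mathcal V^{\mathrm B}_N$. $\mathcal W^{\mathrm B}_N:=\mathbf{k}\oplus\mathcal V^{\mathrm B}_N(X_1-1)$, $\mathcal F^m\mathcal W^{\mathrm B}_N=\mathcal W^{\mathrm B}_N\cap\mathcal F^m\mathcal V^{\mathrm B}_N$. $\mathcal M^{\mathrm B}_N:=\mathcal V^{\mathrm B}_N/\mathcal V^{\mathrm B}_N(X_0-1)$, with $1_{\mathrm B}$ the class of $1$, is filtered by $\mathcal F^m\mathcal M^{\mathrm B}_N=\mathcal F^m\mathcal W^{\mathrm B}_N\cdot1_{\mathrm B}$ (which equals $\mathcal F^m\mathcal V^{\mathrm B}_N\cdot1_{\mathrm B}$), and $\widehat{\mathcal M}^{\mathrm B}_N:=\varprojlim\mathcal M^{\mathrm B}_N/\mathcal F^m\mathcal M^{\mathrm B}_N$. The projection $-\cdot1_{\mathrm B}:\mathcal V^{\mathrm B}_N\to\mathcal M^{\mathrm B}_N$ induces the surjective topological $\mathbf{k}$-module morphism $\widehat{(-\cdot1_{\mathrm B})}:\widehat{\mathcal V}^{\mathrm B}_N\to\widehat{\mathcal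 M}^{\mathrm B}_N$. $\mathrm{iso}^{\mathcal V,\iota}:\widehat{\mathcal V}^{\mathrm B}_N\to\widehat{\mathcal V}^{\mathrm{DR}}_G$ is the unique topological algebra isomorphism with $X_0\mapsto\exp(\frac1Ne_0)g_\iota$, $X_1\mapsto\exp(e_1)$, where $g_\iota=\iota^{-1}(e^{2\pi i/N})$. *)

(* Defs.v *)
From HB Require Import structures.
From mathcomp Require Import all_boot all_order all_algebra all_fingroup.
From mathcomp Require Import cyclic generic_quotient ring_quotient finmap.
From mathcomp Require Import all_classical all_reals topology trigo complex.

Set Implicit Arguments.
Unset Strict Implicit.
Unset Printing Implicit Defensive.

Import Order.TTheory GRing.Theory Num.Theory.

Local Open Scope classical_set_scope.
Local Open Scope ring_scope.

(* The monoid algebra k M (a group algebra when M is a group): the finitely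
   supported functions M -> k, with the convolution product. *)
Definition monoidAlg (k : pzRingType) (M : choiceType) : Type :=
  {fsfun M -> k with 0}.

Section MonoidAlgModule.
Local Open Scope fset_scope.
Local Open Scope ring_scope.
Context (k : pzRingType) (M : choiceType).

HB.instance Definition _ := Choice.copy (monoidAlg k M) {fsfun M -> k with 0}.

Implicit Types (f g h : monoidAlg k M) (x y : M) (c : k).

Definition mcoef f x : k := (f : {fsfun M -> k with 0}) x.
Definition msupp f : {fset M} := finsupp (f : {fsfun M -> k with 0}).
Definition monom c x : monoidAlg k M := [fsfun y in [fset x] => c].

Lemma mcoefP f g : mcoef f =1 mcoef g -> f = g.
Proof. by move=> fg; apply/fsfunP. Qed.

Lemma mcoef_out f x : x \notin msupp f -> mcoef f x = 0.
Proof. exact: fsfun_dflt. Qed.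

Lemma mem_msupp f x : (x \in msupp f) = (mcoef f x != 0).
Proof. by rewrite mem_finsupp. Qed.

Lemma mcoef_monom c x y : mcoef (monom c x) y = c *+ (x == y).
Proof. by rewrite /mcoef fsfunE inE (eq_sym y); case: eqP. Qed.

Lemma msupp_monom c x : msupp (monom c x) `<=` [fset x].
Proof.
apply/fsubsetP => y; rewrite mem_msupp mcoef_monom inE (eq_sym y).
by case: (x == y) => //=; rewrite eqxx.
Qed.

Definition mzero : monoidAlg k M := [fsfun].
Definition mopp f : monoidAlg k M := [fsfun x in msupp f => (- mcoef f x)%R].
Definition madd f g : monoidAlg k M :=
  [fsfun x in msupp f `|` msupp g => (mcoef f x + mcoef g x)%R].
Definition mscale c f : monoidAlg k M :=
  [fsfun x in msupp f => (c * mcoef f x)%R].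

Lemma mcoef_zero x : mcoef mzero x = 0.
Proof. by rewrite /mcoef fsfunE. Qed.

Lemma mcoef_opp f x : mcoef (mopp f) x = - mcoef f x.
Proof.
by rewrite {1}/mcoef fsfunE; case: ifPn => // /mcoef_out ->; rewrite oppr0.
Qed.

Lemma mcoef_add f g x : mcoef (madd f g) x = mcoef f x + mcoef g x.
Proof.
rewrite {1}/mcoef fsfunE inE; case: ifPn => //; rewrite negb_or => /andP[].
by move=> /mcoef_out -> /mcoef_out ->; rewrite addr0.
Qed.

Lemma mcoef_scale c f x : mcoef (mscale c f) x = c * mcoef f x.
Proof.
by rewrite {1}/mcoef fsfunE; case: ifPn => // /mcoef_out ->; rewrite mulr0.
Qed.

Fact maddA : associative madd.
Proof. by move=> f g h; apply: mcoefP => x; rewrite !mcoef_add addrA. Qed.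
Fact maddC : commutative madd.
Proof. by move=> f g; apply: mcoefP => x; rewrite !mcoef_add addrC. Qed.
Fact madd0 : left_id mzero madd.
Proof. by move=> f; apply: mcoefP => x; rewrite mcoef_add mcoef_zero add0r. Qed.
Fact maddN : left_inverse mzero mopp madd.
Proof.
move=> f; apply: mcoefP => x.
by rewrite mcoef_add mcoef_opp mcoef_zero addNr.
Qed.

HB.instance Definition _ :=
  GRing.isZmodule.Build (monoidAlg k M) maddA maddC madd0 maddN.

Fact mscaleA a b f : mscale a (mscale b f) = mscale (a * b) f.
Proof. by apply: mcoefP => x; rewrite !mcoef_scale mulrA. Qed.
Fact mscale1 : left_id 1 mscale.
Proof. by move=> f; apply: mcoefP => x; rewrite mcoef_scale mul1r. Qed.
Fact mscaleDr : right_distributive mscale +%R.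
Proof.
move=> c f g; apply: mcoefP => x.
by rewrite mcoef_scale !mcoef_add !mcoef_scale mulrDr.
Qed.
Fact mscaleDl f : {morph mscale^~ f : a b / a + b}.
Proof.
by move=> a b; apply: mcoefP => x; rewrite mcoef_add !mcoef_scale mulrDl.
Qed.

HB.instance Definition _ := GRing.Zmodule_isLmodule.Build k (monoidAlg k M)
  mscaleA mscale1 mscaleDr mscaleDl.

Lemma mcoefD f g x : mcoef (f + g) x = mcoef f x + mcoef g x.
Proof. exact: mcoef_add. Qed.
Lemma mcoefZ c f x : mcoef (c *: f) x = c * mcoef f x.
Proof. exact: mcoef_scale. Qed.
Lemma mcoefN f x : mcoef (- f) x = - mcoef f x.
Proof. exact: mcoef_opp. Qed.
Lemma mcoef0 x : mcoef 0 x = 0.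
Proof. exact: mcoef_zero. Qed.
Lemma mcoef_sum (I : Type) (r : seq I) (P : pred I) (F : I -> monoidAlg k M) x :
  mcoef (\sum_(i <- r | P i) F i) x = \sum_(i <- r | P i) mcoef (F i) x.
Proof. exact: (big_morph (mcoef^~ x) (fun f g => mcoefD f g x) (mcoef0 x)). Qed.

Lemma monomD a b x : monom (a + b) x = monom a x + monom b x.
Proof. by apply: mcoefP => y; rewrite mcoefD !mcoef_monom mulrnDl. Qed.
Lemma monomZ a b x : monom (a * b) x = a *: monom b x.
Proof. by apply: mcoefP => y; rewrite mcoefZ !mcoef_monom mulrnAr. Qed.
Lemma monom0 x : monom 0 x = 0.
Proof. by apply: mcoefP => y; rewrite mcoef_monom mul0rn mcoef0. Qed.

Lemma msuppD f g : msupp (f + g) `<=` msupp f `|` msupp g.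
Proof.
apply/fsubsetP => x; rewrite inE !mem_msupp mcoefD -negb_and.
by apply: contra => /andP[/eqP -> /eqP ->]; rewrite addr0.
Qed.

Lemma msuppZ c f : msupp (c *: f) `<=` msupp f.
Proof.
apply/fsubsetP => x; rewrite !mem_msupp mcoefZ.
by apply: contra => /eqP ->; rewrite mulr0.
Qed.

Lemma monoidAlgEw (d : {fset M}) f : msupp f `<=` d ->
  f = \sum_(x <- d) monom (mcoef f x) x.
Proof.
move=> /fsubsetP fd; apply: mcoefP => y; rewrite mcoef_sum.
have [yf|yf] := boolP (y \in msupp f).
  rewrite (big_fsetD1 y) ?fd //= mcoef_monom eqxx big1_fset ?addr0 // => x.
  by rewrite in_fsetD1 mcoef_monom => /andP[/negbTE ->].
rewrite (mcoef_out yf) big1_fset // => x _ _; rewrite mcoef_monom.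
by case: eqP => // ->; rewrite (mcoef_out yf).
Qed.

Lemma monoidAlgE f : f = \sum_(x <- msupp f) monom (mcoef f x) x.
Proof. exact: monoidAlgEw. Qed.

End MonoidAlgModule.

Section MonoidAlgRing.
Local Open Scope fset_scope.
Local Open Scope ring_scope.
Context (k : comPzRingType) (M : monoidType).

Implicit Types (f g h : monoidAlg k M) (x y : M) (c : k).

Definition mone : monoidAlg k M := monom 1 1%g.

Definition mmul f g : monoidAlg k M :=
  \sum_(x <- msupp f) \sum_(y <- msupp g)
    monom (mcoef f x * mcoef g y) (x * y)%g.

Lemma mmulw (d1 d2 : {fset M}) f g : msupp f `<=` d1 -> msupp g `<=` d2 ->
  mmul f g =
  \sum_(x <- d1) \sum_(y <- d2) monom (mcoef f x * mcoef g y) (x * y)%g.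
Proof.
move=> le1 le2; rewrite /mmul (big_fset_incl _ le1) /=.
  apply: eq_bigr => x _; apply: (big_fset_incl _ le2) => y _ /mcoef_out ->.
  by rewrite mulr0 monom0.
move=> x _ /mcoef_out fx; rewrite big1 // => y _.
by rewrite fx mul0r monom0.
Qed.

Fact mmulDl : left_distributive mmul +%R.
Proof.
move=> f g h; have le := fsubset_refl (msupp h).
rewrite (mmulw (msuppD f g) le) (mmulw (fsubsetUl _ (msupp g)) le).
rewrite (mmulw (fsubsetUr (msupp f) _) le) -big_split; apply: eq_bigr => x _.
rewrite -big_split; apply: eq_bigr => y _.
by rewrite mcoefD mulrDl monomD.
Qed.

Fact mmulDr : right_distributive mmul +%R.
Proof.
move=> h f g; have le := fsubset_refl (msupp h).
rewrite (mmulw le (msuppD f g)) (mmulw le (fsubsetUl _ (msupp g))).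
rewrite (mmulw le (fsubsetUr (msupp f) _)) -big_split; apply: eq_bigr => x _.
rewrite -big_split; apply: eq_bigr => y _.
by rewrite mcoefD mulrDr monomD.
Qed.

Fact mmulZl c f g : c *: mmul f g = mmul (c *: f) g.
Proof.
rewrite (mmulw (msuppZ c f) (fsubset_refl _)) scaler_sumr.
apply: eq_bigr => x _; rewrite scaler_sumr; apply: eq_bigr => y _.
by rewrite mcoefZ -mulrA -monomZ.
Qed.

Fact mmulZr c f g : c *: mmul f g = mmul f (c *: g).
Proof.
rewrite (mmulw (fsubset_refl _) (msuppZ c g)) scaler_sumr.
apply: eq_bigr => x _; rewrite scaler_sumr; apply: eq_bigr => y _.
by rewrite mcoefZ mulrCA -monomZ.
Qed.

Fact mmul_monom a b x y : mmul (monom a x) (monom b y) = monom (a * b) (x * y)%g.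
Proof.
rewrite (mmulw (msupp_monom a x) (msupp_monom b y)) !big_seq_fset1.
by rewrite !mcoef_monom !eqxx.
Qed.

Lemma mmul_suml (I : Type) (r : seq I) (F : I -> monoidAlg k M) g :
  mmul (\sum_(i <- r) F i) g = \sum_(i <- r) mmul (F i) g.
Proof.
apply: (big_morph (mmul^~ g)) => [f1 f2|]; first exact: mmulDl.
by apply: (@addrI _ (mmul 0 g)); rewrite -mmulDl !addr0.
Qed.

Lemma mmul_sumr (I : Type) (r : seq I) (F : I -> monoidAlg k M) g :
  mmul g (\sum_(i <- r) F i) = \sum_(i <- r) mmul g (F i).
Proof.
apply: (big_morph (mmul g)) => [f1 f2|]; first exact: mmulDr.
by apply: (@addrI _ (mmul g 0)); rewrite -mmulDr !addr0.
Qed.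

Fact mmulA : associative mmul.
Proof.
move=> f g h; rewrite (monoidAlgE f) (monoidAlgE g) (monoidAlgE h).
rewrite !mmul_suml; apply: eq_bigr => x _.
rewrite [LHS]mmul_sumr [X in _ = mmul X _]mmul_sumr mmul_suml.
apply: eq_bigr => y _.
rewrite !mmul_sumr; apply: eq_bigr => z _.
by rewrite !mmul_monom mulrA mulgA.
Qed.

Fact mmul1 : left_id mone mmul.
Proof.
move=> f; rewrite (monoidAlgE f) mmul_sumr; apply: eq_bigr => x _.
by rewrite mmul_monom mul1r mul1g.
Qed.

Fact mmulr1 : right_id mone mmul.
Proof.
move=> f; rewrite (monoidAlgE f) mmul_suml; apply: eq_bigr => x _.
by rewrite mmul_monom mulr1 mulg1.
Qed.

HB.instance Definition _ := GRing.Zmodule_isPzRing.Build (monoidAlg k M)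
  mmulA mmul1 mmulr1 mmulDl mmulDr.

Lemma mscaleAl c f g : c *: (f * g) = (c *: f) * g.
Proof. exact: mmulZl. Qed.

Lemma mscaleAr c f g : c *: (f * g) = f * (c *: g).
Proof. exact: mmulZr. Qed.

Lemma monomM a b x y :
  monom a x * monom b y = monom (a * b) (x * y)%g :> monoidAlg k M.
Proof. exact: mmul_monom. Qed.

Lemma monom1 : monom 1 1%g = 1 :> monoidAlg k M.
Proof. by []. Qed.

End MonoidAlgRing.

Record submodule (k : pzRingType) (V : lmodType k) := Submodule {
  submodule_set :> V -> Prop;
  submodule0 : submodule_set 0;
  submoduleP : forall (c : k) (x y : V),
    submodule_set x -> submodule_set y -> submodule_set (c *: x + y)
}.

Section SubmoduleTheory.
Context (k : pzRingType) (V : lmodType k) (S : submodule V).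

Lemma submoduleD x y : S x -> S y -> S (x + y).
Proof. by move=> Sx Sy; rewrite -[x]scale1r; apply: submoduleP. Qed.

Lemma submoduleZ c x : S x -> S (c *: x).
Proof. by move=> Sx; rewrite -[_ *: x]addr0; apply/submoduleP/submodule0. Qed.

Lemma submoduleN x : S x -> S (- x).
Proof. by rewrite -scaleN1r; apply: submoduleZ. Qed.

Lemma submoduleB x y : S x -> S y -> S (x - y).
Proof. by move=> Sx Sy; apply/submoduleD/submoduleN. Qed.

Lemma submodule_sum (I : eqType) (r : seq I) (F : I -> V) :
  (forall i, i \in r -> S (F i)) -> S (\sum_(i <- r) F i).
Proof.
move=> SF; rewrite big_seq; apply: big_ind => //; first exact: submodule0.
exact: submoduleD.
Qed.

Definition submodule_pred : {pred V} := fun x => `[< S x >].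

Fact submodule_zmod_closed : zmod_closed submodule_pred.
Proof.
split=> [|x y]; first exact/asboolP/submodule0.
by move=> /asboolP Sx /asboolP Sy; apply/asboolP/submoduleB.
Qed.

HB.instance Definition _ :=
  GRing.isZmodClosed.Build V submodule_pred submodule_zmod_closed.

(* The quotient module V / S *)
Definition lquot : Type := Quotient.quot submodule_pred.

HB.instance Definition _ := Choice.on lquot.
HB.instance Definition _ := Quotient.on lquot.
HB.instance Definition _ := GRing.Zmodule.on lquot.

Definition lpi : V -> lquot := \pi_lquot%qT.

Lemma lpiE x y : (lpi x = lpi y) <-> S (x - y).
Proof.
have := Quotient.idealrBE submodule_pred x y.
rewrite unfold_in => e; split=> [/eqP|Sxy].
  by move=> h; apply/asboolP; rewrite e.
by apply/eqP; rewrite /lpi -e; apply/asboolP.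
Qed.

Lemma lpiK (q : lquot) : lpi (repr q) = q.
Proof. exact: reprK. Qed.

Fact lpi_zmod_morphism : zmod_morphism lpi.
Proof.
move=> x y; rewrite /lpi.
rewrite -[\pi_lquot%qT]/(\pi_(Quotient.quot submodule_pred))%qT.
exact: raddfB.
Qed.
HB.instance Definition _ := GRing.isZmodMorphism.Build V lquot lpi lpi_zmod_morphism.

Definition lquot_scale (c : k) (q : lquot) : lquot := lpi (c *: repr q).

Fact lquot_scale_pi c x : lquot_scale c (lpi x) = lpi (c *: x).
Proof.
apply/lpiE; rewrite -scalerBr; apply: submoduleZ.
by apply/lpiE; rewrite lpiK.
Qed.

Fact lquot_scaleA a b q : lquot_scale a (lquot_scale b q) = lquot_scale (a * b) q.
Proof. by rewrite -[q]lpiK !lquot_scale_pi scalerA. Qed.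
Fact lquot_scale1 : left_id 1 lquot_scale.
Proof. by move=> q; rewrite -[q]lpiK lquot_scale_pi scale1r. Qed.
Fact lquot_scaleDr : right_distributive lquot_scale +%R.
Proof.
move=> c p q; rewrite -[p]lpiK -[q]lpiK -raddfD !lquot_scale_pi -raddfD.
by rewrite scalerDr.
Qed.
Fact lquot_scaleDl q : {morph lquot_scale^~ q : a b / a + b}.
Proof.
by move=> a b; rewrite -[q]lpiK !lquot_scale_pi -raddfD scalerDl.
Qed.

HB.instance Definition _ := GRing.Zmodule_isLmodule.Build k lquot
  lquot_scaleA lquot_scale1 lquot_scaleDr lquot_scaleDl.

Fact lpi_scalable : scalable lpi.
Proof. by move=> c x; rewrite -lquot_scale_pi. Qed.
HB.instance Definition _ := GRing.isScalable.Build k V lquot *:%R lpi lpi_scalable.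

End SubmoduleTheory.

Record filtration (k : pzRingType) (V : lmodType k) := Filtration {
  filt :> nat -> submodule V;
  filt_decr : forall m n, (m <= n)%N -> forall v, filt n v -> filt m v
}.

Section Completion.
Context (k : pzRingType) (V : lmodType k) (F : filtration V).

(* The transition map V / F n -> V / F m, for m <= n, sends the class of v to
   the class of v. *)
Record completion := Completion {
  coord : forall m, lquot (F m);
  coord_compat : forall m n, (m <= n)%N -> lpi (F m) (repr (coord n)) = coord m
}.

HB.instance Definition _ := gen_eqMixin completion.
HB.instance Definition _ := gen_choiceMixin completion.

Implicit Types x y z : completion.

Lemma completionP x y : (forall m, coord x m = coord y m) -> x = y.
Proof.
case: x y => [x xc] [y yc] /= xy.
have {}xy : x = y by apply: functional_extensionality_dep.
by case: _ / xy yc => yc; congr Completion; apply: Prop_irrelevance.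
Qed.

Lemma lpi_repr m n v : (m <= n)%N -> lpi (F m) (repr (lpi (F n) v)) = lpi (F m) v.
Proof. by move=> mn; apply/lpiE/(filt_decr mn)/lpiE; rewrite lpiK. Qed.

(* The canonical map V -> lim V / F m *)
Definition to_completion (v : V) : completion :=
  Completion (fun m n mn => @lpi_repr m n v mn).

Fact czero_compat m n : (m <= n)%N -> lpi (F m) (repr (0 : lquot (F n))) = 0.
Proof. by move=> mn; rewrite -(raddf0 (lpi (F n))) lpi_repr // raddf0. Qed.

Fact copp_compat x m n : (m <= n)%N ->
  lpi (F m) (repr (- coord x n)) = - coord x m.
Proof.
move=> mn; rewrite -(coord_compat x mn) -{1}(lpiK (coord x n)) -raddfN.
by rewrite lpi_repr // raddfN.
Qed.

Fact cadd_compat x y m n : (m <= n)%N ->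
  lpi (F m) (repr (coord x n + coord y n)) = coord x m + coord y m.
Proof.
move=> mn; rewrite -(coord_compat x mn) -(coord_compat y mn).
rewrite -{1}(lpiK (coord x n)) -{1}(lpiK (coord y n)) -raddfD.
by rewrite lpi_repr // raddfD.
Qed.

Fact cscale_compat c x m n : (m <= n)%N ->
  lpi (F m) (repr (c *: coord x n)) = c *: coord x m.
Proof.
move=> mn; rewrite -(coord_compat x mn) -{1}(lpiK (coord x n)) -linearZ.
by rewrite /= lpi_repr // linearZ.
Qed.

Definition czero := Completion czero_compat.
Definition copp x := Completion (copp_compat x).
Definition cadd x y := Completion (cadd_compat x y).
Definition cscale c x := Completion (cscale_compat c x).

Fact caddA : associative cadd.
Proof. by move=> x y z; apply: completionP => m; apply: addrA. Qed.
Fact caddC : commutative cadd.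
Proof. by move=> x y; apply: completionP => m; apply: addrC. Qed.
Fact cadd0 : left_id czero cadd.
Proof. by move=> x; apply: completionP => m; apply: add0r. Qed.
Fact caddN : left_inverse czero copp cadd.
Proof. by move=> x; apply: completionP => m; apply: addNr. Qed.

HB.instance Definition _ := GRing.isZmodule.Build completion caddA caddC cadd0 caddN.

Fact cscaleA a b x : cscale a (cscale b x) = cscale (a * b) x.
Proof. by apply: completionP => m; apply: scalerA. Qed.
Fact cscale1 : left_id 1 cscale.
Proof. by move=> x; apply: completionP => m; apply: scale1r. Qed.
Fact cscaleDr : right_distributive cscale +%R.
Proof. by move=> c x y; apply: completionP => m; apply: scalerDr. Qed.
Fact cscaleDl x : {morph cscale^~ x : a b / a + b}.
Proof. by move=> a b; apply: completionP => m; apply: scalerDl. Qed.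

HB.instance Definition _ := GRing.Zmodule_isLmodule.Build k completion
  cscaleA cscale1 cscaleDr cscaleDl.

Fact to_completion_linear : linear to_completion.
Proof. by move=> c u v; apply: completionP => m; apply: linearP. Qed.
HB.instance Definition _ :=
  GRing.isLinear.Build k V completion *:%R to_completion to_completion_linear.

HB.instance Definition _ := isPointed.Build completion 0.

(* The inverse limit topology, each V / F m being discrete: the sets
   {y | coord y m = coord x m} form a neighborhood basis at x. *)
Definition cnbhs (x : completion) : set_system completion :=
  filter_from setT (fun m => [set y | coord y m = coord x m]).

HB.instance Definition _ := hasNbhs.Build completion cnbhs.

Lemma coord_eq_le x y m n : (m <= n)%N -> coord x n = coord y n ->
  coord x m = coord y m.
Proof. by move=> mn e; rewrite -(coord_compat x mn) -(coord_compat y mn) e. Qed.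

Fact cnbhs_filter x : ProperFilter (nbhs x).
Proof.
apply: filter_from_proper => [|m _]; last by exists x.
apply: filter_from_filter; first by exists 0%N.
move=> m n _ _; exists (maxn m n) => // y e; split.
  by apply: coord_eq_le e; apply: leq_maxl.
by apply: coord_eq_le e; apply: leq_maxr.
Qed.

Fact cnbhs_singleton x (A : set completion) : nbhs x A -> A x.
Proof. by move=> [m _]; apply. Qed.

Fact cnbhs_nbhs x (A : set completion) : nbhs x A -> nbhs x (nbhs^~ A).
Proof.
move=> [m _ mA]; exists m => // y yx; exists m => // z zy.
by apply: mA => /=; rewrite zy.
Qed.

HB.instance Definition _ := Nbhs_isNbhsTopological.Build completion
  cnbhs_filter cnbhs_singleton cnbhs_nbhs.

End Completion.

Section CompletionMap.
Context (k : pzRingType) (V W : lmodType k).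
Context (F : filtration V) (G : filtration W) (f : {linear V -> W}).
Context (fFG : forall m v, F m v -> G m (f v)).

Lemma cmap_compat (x : completion F) m n : (m <= n)%N ->
  lpi (G m) (repr (lpi (G n) (f (repr (coord x n))))) =
  lpi (G m) (f (repr (coord x m))).
Proof.
move=> mn; rewrite lpi_repr //; apply/lpiE; rewrite -raddfB; apply: fFG.
by apply/lpiE; rewrite lpiK coord_compat.
Qed.

(* The map lim V / F m -> lim W / G m induced by f. *)
Definition completion_map (x : completion F) : completion G :=
  Completion (cmap_compat x).

End CompletionMap.

(* Filtrations of a monoid algebra by two-sided ideals; the completion is then
   an algebra. *)
Record ideal_filtration (k : comPzRingType) (M : monoidType) := IdealFiltration {
  ideal_filt :> filtration (monoidAlg k M);
  ideal_filtMl : forall m a x, ideal_filt m x -> ideal_filt m (a * x);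
  ideal_filtMr : forall m a x, ideal_filt m x -> ideal_filt m (x * a)
}.

Section CompletionRing.
Context (k : comPzRingType) (M : monoidType) (F : ideal_filtration k M).

Implicit Types x y z : completion F.

Fact lquot_mul m a b a' b' : lpi (F m) a = lpi (F m) a' ->
  lpi (F m) b = lpi (F m) b' -> lpi (F m) (a * b) = lpi (F m) (a' * b').
Proof.
move=> /lpiE ea /lpiE eb; apply/lpiE.
rewrite -(subrK (a' * b) (a * b)) -addrA -mulrBl -mulrBr.
by apply: submoduleD; [apply: ideal_filtMr|apply: ideal_filtMl].
Qed.

Fact cmul_compat x y m n : (m <= n)%N ->
  lpi (F m) (repr (lpi (F n) (repr (coord x n) * repr (coord y n)))) =
  lpi (F m) (repr (coord x m) * repr (coord y m)).
Proof.
by move=> mn; rewrite lpi_repr //; apply: lquot_mul; rewrite lpiK coord_compat.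
Qed.

Definition cmul x y := Completion (cmul_compat x y).
Definition cone : completion F := to_completion F 1.

Fact cmulA : associative cmul.
Proof.
move=> x y z; apply: completionP => m /=.
transitivity (lpi (F m)
  (repr (coord x m) * (repr (coord y m) * repr (coord z m)))).
  by apply: lquot_mul => //; rewrite lpiK.
by rewrite mulrA; apply: lquot_mul => //; rewrite lpiK.
Qed.
Fact cmul1 : left_id cone cmul.
Proof.
move=> x; apply: completionP => m /=.
transitivity (lpi (F m) (1 * repr (coord x m))); last by rewrite mul1r lpiK.
by apply: lquot_mul => //; rewrite lpiK.
Qed.
Fact cmulr1 : right_id cone cmul.
Proof.
move=> x; apply: completionP => m /=.
transitivity (lpi (F m) (repr (coord x m) * 1)); last by rewrite mulr1 lpiK.
by apply: lquot_mul => //; rewrite lpiK.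
Qed.
Fact cmulDl : left_distributive cmul +%R.
Proof.
move=> x y z; apply: completionP => m /=; 
transitivity (lpi (F m)
  ((repr (coord x m) + repr (coord y m)) * repr (coord z m))); last first.
  by rewrite mulrDl raddfD.
by apply: lquot_mul => //; rewrite lpiK raddfD /= !lpiK.
Qed.
Fact cmulDr : right_distributive cmul +%R.
Proof.
move=> x y z; apply: completionP => m /=; 
transitivity (lpi (F m)
  (repr (coord x m) * (repr (coord y m) + repr (coord z m)))); last first.
  by rewrite mulrDr raddfD.
by apply: lquot_mul => //; rewrite lpiK raddfD /= !lpiK.
Qed.

HB.instance Definition _ := GRing.Zmodule_isPzRing.Build (completion F)
  cmulA cmul1 cmulr1 cmulDl cmulDr.

Lemma cscaleAl c x y : c *: (x * y) = (c *: x) * y.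
Proof.
apply: completionP => m /=; rewrite -linearZ /= mscaleAl.
by apply: lquot_mul => //; rewrite linearZ /= !lpiK.
Qed.
Lemma cscaleAr c x y : c *: (x * y) = x * (c *: y).
Proof.
apply: completionP => m /=; rewrite -linearZ /= mscaleAr.
by apply: lquot_mul => //; rewrite linearZ /= !lpiK.
Qed.

Lemma to_completionM a b :
  to_completion F (a * b) = to_completion F a * to_completion F b.
Proof. by apply: completionP => m /=; apply: lquot_mul; rewrite lpiK. Qed.

End CompletionRing.

Section MonoidAlgMap.
Context (k : comPzRingType) (M M' : choiceType) (phi : M -> M').
Local Open Scope fset_scope.

(* The k-linear map k M -> k M' extending phi. *)
Definition monoidAlg_map (f : monoidAlg k M) : monoidAlg k M' :=
  \sum_(x <- msupp f) monom (mcoef f x) (phi x).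

Lemma monoidAlg_mapEw (d : {fset M}) f : msupp f `<=` d ->
  monoidAlg_map f = \sum_(x <- d) monom (mcoef f x) (phi x).
Proof.
by move=> le; apply: (big_fset_incl _ le) => x _ /mcoef_out ->; rewrite monom0.
Qed.

Fact monoidAlg_map_linear : linear monoidAlg_map.
Proof.
move=> c f g; have le := fsubset_trans (msuppD (c *: f) g)
  (fsetSU (msupp g) (msuppZ c f)).
rewrite (monoidAlg_mapEw le) (monoidAlg_mapEw (fsubsetUl _ (msupp g))).
rewrite (monoidAlg_mapEw (fsubsetUr (msupp f) _)) scaler_sumr -big_split.
by apply: eq_bigr => x _; rewrite mcoefD mcoefZ monomD monomZ.
Qed.
HB.instance Definition _ := GRing.isLinear.Build k (monoidAlg k M)
  (monoidAlg k M') *:%R monoidAlg_map monoidAlg_map_linear.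

Lemma monoidAlg_map_monom c x : monoidAlg_map (monom c x) = monom c (phi x).
Proof.
rewrite (monoidAlg_mapEw (msupp_monom c x)) big_seq_fset1.
by rewrite mcoef_monom eqxx.
Qed.

End MonoidAlgMap.

Lemma monoidAlg_mapM (k : comPzRingType) (M M' : monoidType) (phi : M -> M') :
  {morph phi : x y / (x * y)%g} ->
  {morph @monoidAlg_map k M M' phi : f g / f * g}.
Proof.
move=> phiM f g; rewrite (monoidAlgE f) (monoidAlgE g).
rewrite mulr_suml !raddf_sum mulr_suml; apply: eq_bigr => x _ /=.
rewrite !mulr_sumr raddf_sum; apply: eq_bigr => y _ /=.
by rewrite monomM !monoidAlg_map_monom monomM phiM.
Qed.

(* The free group on X_0, X_1 as the group of reduced words; the letter
   (b, false) stands for X_b and (b, true) for its inverse, where b : bool. *)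
Definition letter := (bool * bool)%type.
Definition linv (a : letter) : letter := (a.1, ~~ a.2).
Definition reduced (w : seq letter) : bool := sorted (fun a b => b != linv a) w.

Record F2 := FreeGroup2 { F2_word : seq letter; _ : reduced F2_word }.
HB.instance Definition _ := [isSub for F2_word].
HB.instance Definition _ := [Choice of F2 by <:].

Lemma linvK : involutive linv.
Proof. by case=> a b; rewrite /linv /= negbK. Qed.

Definition lcons (a : letter) (w : seq letter) : seq letter :=
  if w is b :: w' then if b == linv a then w' else a :: w else [:: a].

Definition wmul (u v : seq letter) : seq letter := foldr lcons v u.
Definition winv (u : seq letter) : seq letter := rev (map linv u).

Lemma reduced_behead a w : reduced (a :: w) -> reduced w.
Proof. exact: path_sorted. Qed.

Lemma reduced_lcons a w : reduced w -> reduced (lcons a w).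
Proof.
case: w => [//|b w] /=; case: ifPn => [_|ba] bw; first exact: path_sorted bw.
by rewrite /reduced /= ba.
Qed.

Lemma lconsE a w : reduced (a :: w) -> lcons a w = a :: w.
Proof. by case: w => [//|b w] /= /andP[/negbTE -> _]. Qed.

Lemma lconsK a w : reduced w -> lcons a (lcons (linv a) w) = w.
Proof.
case: w => [_|b w] /=; first by rewrite eqxx.
rewrite linvK; case: eqP => [->|_] bw; last by rewrite /= eqxx.
exact: lconsE.
Qed.

Lemma lconsVK a w : reduced w -> lcons (linv a) (lcons a w) = w.
Proof. by move=> rw; rewrite -{2}[a]linvK lconsK. Qed.

Lemma reduced_wmul u v : reduced v -> reduced (wmul u v).
Proof. by move=> rv; elim: u => //= a u; apply: reduced_lcons. Qed.

Lemma wmul_lcons a u v : reduced v ->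
  wmul (lcons a u) v = lcons a (wmul u v).
Proof.
move=> rv; case: u => [//|b u] /=; case: eqP => [->|//].
by rewrite lconsK // reduced_wmul.
Qed.

Lemma wmulA u v w : reduced w -> wmul u (wmul v w) = wmul (wmul u v) w.
Proof.
by move=> rw; elim: u => //= a u IH; rewrite wmul_lcons ?IH.
Qed.

Lemma wmulr1 u : reduced u -> wmul u [::] = u.
Proof.
by elim: u => //= a u IH au; rewrite IH ?lconsE //; apply: reduced_behead au.
Qed.

Lemma reduced_winv u : reduced u -> reduced (winv u).
Proof.
rewrite /reduced /winv rev_sorted sorted_map; apply: sub_sorted => a b /=.
by rewrite linvK; apply: contra => /eqP ->.
Qed.

Lemma winvK : involutive winv.
Proof. by move=> u; rewrite /winv map_rev revK mapK //; apply: linvK. Qed.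

Lemma wmulVK u v : reduced v -> wmul (winv u) (wmul u v) = v.
Proof.
move=> rv; elim: u => //= a u IH.
rewrite /winv /= rev_cons /wmul foldr_rcons lconsVK; first exact: IH.
exact: reduced_wmul.
Qed.

Lemma F2P (x : F2) : reduced (F2_word x).
Proof. by case: x. Qed.

Definition F2_mul (x y : F2) : F2 :=
  FreeGroup2 (reduced_wmul (F2_word x) (F2P y)).
Definition F2_one : F2 := @FreeGroup2 [::] isT.
Definition F2_inv (x : F2) : F2 := FreeGroup2 (reduced_winv (F2P x)).

Fact F2_mulA : associative F2_mul.
Proof. by move=> x y z; apply/val_inj/wmulA/F2P. Qed.
Fact F2_mul1 : left_id F2_one F2_mul.
Proof. by move=> x; apply: val_inj. Qed.
Fact F2_mulr1 : right_id F2_one F2_mul.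
Proof. by move=> x; apply/val_inj/wmulr1/F2P. Qed.
Fact F2_mulV : left_inverse F2_one F2_inv F2_mul.
Proof.
move=> x; apply: val_inj => /=.
by rewrite -[X in wmul _ X](wmulr1 (F2P x)) wmulVK.
Qed.
Fact F2_mulrV : right_inverse F2_one F2_inv F2_mul.
Proof.
move=> x; rewrite -{1}[x](_ : F2_inv (F2_inv x) = x) ?F2_mulV //.
by apply: val_inj; apply: winvK.
Qed.

HB.instance Definition _ :=
  isGroup.Build F2 F2_mulA F2_mul1 F2_mulr1 F2_mulV F2_mulrV.

Definition F2_gen (b : bool) : F2 := @FreeGroup2 [:: (b, false)] isT.

Section FreeGroupMorphism.
Context (H : groupType) (h : bool -> H).
Local Open Scope group_scope.

Definition letter_eval (a : letter) : H := if a.2 then (h a.1)^-1 else h a.1.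

(* The group morphism F_2 -> H with X_b |-> h b *)
Definition F2_morphism (x : F2) : H :=
  foldr (fun a y => letter_eval a * y) 1 (F2_word x).

Fact F2_morphismM : {morph F2_morphism : x y / x * y}.
Proof.
have evV a : letter_eval (linv a) = (letter_eval a)^-1.
  by case: a => b []; rewrite /letter_eval //= invgK.
move=> [u ru] [v rv]; rewrite /F2_morphism /=.
elim: u {ru} => [|a u IH] /=; first by rewrite mul1g.
rewrite -mulgA -IH; case: (wmul u v) => [//|b w] /=.
by case: eqP => [->|//]; rewrite evV mulKVg.
Qed.

Lemma F2_morphism_gen b : F2_morphism (F2_gen b) = h b.
Proof. by rewrite /F2_morphism /= mulg1. Qed.

End FreeGroupMorphism.

Section RootsOfUnity.
Context (R : realType).

(* The multiplicative group of the complex numbers *)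
Record Cx := NonzeroComplex { Cx_val : R[i]; _ : Cx_val != 0 }.
HB.instance Definition _ := [isSub for Cx_val].
HB.instance Definition _ := [Choice of Cx by <:].

Lemma Cx_neq0 (z : Cx) : Cx_val z != 0.
Proof. by case: z. Qed.

Fact Cx_mul_subproof (z w : Cx) : Cx_val z * Cx_val w != 0.
Proof. by rewrite mulf_neq0 ?Cx_neq0. Qed.
Fact Cx_inv_subproof (z : Cx) : (Cx_val z)^-1 != 0.
Proof. by rewrite invr_neq0 ?Cx_neq0. Qed.

Definition Cx_mul (z w : Cx) : Cx := NonzeroComplex (Cx_mul_subproof z w).
Definition Cx_one : Cx := NonzeroComplex (oner_neq0 _).
Definition Cx_inv (z : Cx) : Cx := NonzeroComplex (Cx_inv_subproof z).

Fact Cx_mulA : associative Cx_mul.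
Proof. by move=> x y z; apply/val_inj/mulrA. Qed.
Fact Cx_mul1 : left_id Cx_one Cx_mul.
Proof. by move=> x; apply/val_inj/mul1r. Qed.
Fact Cx_mulr1 : right_id Cx_one Cx_mul.
Proof. by move=> x; apply/val_inj/mulr1. Qed.
Fact Cx_mulV : left_inverse Cx_one Cx_inv Cx_mul.
Proof. by move=> x; apply/val_inj/mulVf/Cx_neq0. Qed.
Fact Cx_mulrV : right_inverse Cx_one Cx_inv Cx_mul.
Proof. by move=> x; apply/val_inj/mulfV/Cx_neq0. Qed.

HB.instance Definition _ :=
  isGroup.Build Cx Cx_mulA Cx_mul1 Cx_mulr1 Cx_mulV Cx_mulrV.

Definition mu_pred (N : nat) : pred Cx := fun z => (z ^+ N == 1)%g.

Fact mu_closed N : group_closed (mu_pred N).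
Proof.
split=> [|z w]; rewrite !unfold_in ?expg1n // => /eqP zN /eqP wN.
rewrite expgMn ?zN ?expVgn ?wN ?invg1 ?mulg1 //.
by apply: val_inj; apply: mulrC.
Qed.

(* The group of N-th roots of unity *)
Record mu (N : nat) := Mu { mu_val : Cx; _ : mu_pred N mu_val }.
HB.instance Definition _ N := [isSub for @mu_val N].
HB.instance Definition _ N := [Choice of mu N by <:].
HB.instance Definition _ N :=
  SubChoice_isSubGroup.Build Cx (mu_pred N) (mu N) (mu_closed N).

(* exp (2 i pi / N) *)
Definition zetaC (N : nat) : R[i] :=
  let t := 2 * pi / N%:R in (cos t +i* sin t)%C.

Lemma deMoivre (t : R) n :
  (cos t +i* sin t)%C ^+ n = (cos (t *+ n) +i* sin (t *+ n))%C.
Proof.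
elim: n => [|n IH]; first by rewrite expr0 mulr0n cos0 sin0.
rewrite exprSr IH mulrSr cosD sinD; congr (_ +i* _)%C.
by rewrite addrC.
Qed.

Fact zetaC_neq0 N : zetaC N != 0.
Proof.
rewrite /zetaC; set t : R := _ / _; apply/eqP => -[c0 s0].
have := cos2Dsin2 t.
by rewrite c0 s0 !expr0n addr0 => /eqP; rewrite eq_sym oner_eq0.
Qed.

Definition zeta_Cx N : Cx := NonzeroComplex (zetaC_neq0 N).

Fact zetaC_mu N : mu_pred N (zeta_Cx N).
Proof.
apply/eqP/val_inj; transitivity (zetaC N ^+ N).
  by elim: {2 4}N => // n IH; rewrite expgSr exprSr /= IH.
rewrite deMoivre; case: N => [|N]; first by rewrite mulr0n cos0 sin0.
rewrite -[_ / _ *+ _]mulr_natr divfK ?pnatr_eq0 // mulrC mulr_natr.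
by rewrite cos2pi sin2pi.
Qed.

Definition zeta N : mu N := Mu (zetaC_mu N).

End RootsOfUnity.

Section Betti.
Context (R : realType) (k : comPzRingType) (N : nat).

Local Notation V := (monoidAlg k F2).

Definition X0 : V := monom 1 (F2_gen false).
Definition X1 : V := monom 1 (F2_gen true).

Definition F2_to_mu : F2 -> mu R N :=
  F2_morphism (fun b => if b then 1%g else zeta R N).

(* The ideal I *)
Definition B_ideal (f : V) : Prop := monoidAlg_map F2_to_mu f = 0.

(* The powers of I; I ^ 0 is the whole algebra. *)
Fixpoint B_ideal_exp (m : nat) (f : V) : Prop :=
  if m is m'.+1 then
    exists s : seq (V * V),
      (forall p, p \in s -> B_ideal_exp m' p.1 /\ B_ideal p.2)
      /\ f = \sum_(p <- s) p.1 * p.2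
  else True.

Lemma F2_to_muM : {morph F2_to_mu : x y / (x * y)%g}.
Proof. exact: F2_morphismM. Qed.

Lemma B_idealMl a f : B_ideal f -> B_ideal (a * f).
Proof.
by move=> If; rewrite /B_ideal monoidAlg_mapM ?If ?mulr0 //; apply: F2_to_muM.
Qed.

Lemma B_idealMr a f : B_ideal f -> B_ideal (f * a).
Proof.
by move=> If; rewrite /B_ideal monoidAlg_mapM ?If ?mul0r //; apply: F2_to_muM.
Qed.

Fact B_ideal_exp0 m : B_ideal_exp m 0.
Proof. by case: m => //= m; exists [::]; rewrite big_nil. Qed.

Lemma B_ideal_expD m f g :
  B_ideal_exp m f -> B_ideal_exp m g -> B_ideal_exp m (f + g).
Proof.
case: m => //= m [s [sI ->]] [t [tI ->]]; exists (s ++ t); rewrite big_cat.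
by split=> // p; rewrite mem_cat => /orP[/sI|/tI].
Qed.

Lemma B_ideal_expMl m a f : B_ideal_exp m f -> B_ideal_exp m (a * f).
Proof.
elim: m a f => //= m IH a _ [s [sI ->]].
exists [seq (a * p.1, p.2) | p <- s]; split.
  by move=> _ /mapP[p /sI[p1 p2] ->]; split=> //; apply: IH.
by rewrite big_map mulr_sumr; apply: eq_bigr => p _; rewrite mulrA.
Qed.

Lemma B_ideal_expMr m a f : B_ideal_exp m f -> B_ideal_exp m (f * a).
Proof.
case: m => //= m [s [sI ->]].
exists [seq (p.1, p.2 * a) | p <- s]; split.
  by move=> _ /mapP[p /sI[p1 p2] ->]; split=> //; apply: B_idealMr.
by rewrite big_map mulr_suml; apply: eq_bigr => p _; rewrite mulrA.
Qed.

Fact B_ideal_expP m (c : k) f g :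
  B_ideal_exp m f -> B_ideal_exp m g -> B_ideal_exp m (c *: f + g).
Proof.
move=> mf; apply: B_ideal_expD; rewrite -[f]mul1r mscaleAl.
exact: B_ideal_expMl.
Qed.

Definition B_ideal_exp_submodule m : submodule V :=
  Submodule (B_ideal_exp0 m) (@B_ideal_expP m).

Lemma B_ideal_expS m f : B_ideal_exp m.+1 f -> B_ideal_exp m f.
Proof.
move=> [s [sI ->]]; apply: (submodule_sum (S := B_ideal_exp_submodule m)).
by move=> p /sI[p1 _]; apply: B_ideal_expMr.
Qed.

Fact B_filtration_decr m n : (m <= n)%N ->
  forall f, B_ideal_exp_submodule n f -> B_ideal_exp_submodule m f.
Proof.
move=> /subnK <-; elim: (n - m)%N => // p IH f pf.
by apply: IH; apply: B_ideal_expS.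
Qed.

(* F ^ m V ^ B = I ^ m *)
Definition VB_filtration : ideal_filtration k F2 :=
  IdealFiltration (ideal_filt := Filtration B_filtration_decr)
    B_ideal_expMl B_ideal_expMr.

(* W ^ B = k (+) V ^ B (X_1 - 1); F ^ m W ^ B is its intersection with I ^ m *)
Definition WB (f : V) : Prop :=
  exists (c : k) (a : V), f = c *: (1 : V) + a * (X1 - 1).

Definition WB_filt (m : nat) (f : V) : Prop := WB f /\ VB_filtration m f.

(* V ^ B (X_0 - 1) *)
Definition MB_kernel_set (f : V) : Prop := exists a, f = a * (X0 - 1).

Fact MB_kernel0 : MB_kernel_set 0.
Proof. by exists 0; rewrite mul0r. Qed.
Fact MB_kernelP (c : k) f g :
  MB_kernel_set f -> MB_kernel_set g -> MB_kernel_set (c *: f + g).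
Proof.
by move=> [a ->] [b ->]; exists (c *: a + b); rewrite mulrDl mscaleAl.
Qed.
Definition MB_kernel : submodule V := Submodule MB_kernel0 MB_kernelP.

(* M ^ B; the map lpi MB_kernel : V ^ B -> M ^ B is the projection - . 1_B *)
Local Notation M := (lquot MB_kernel).

(* F ^ m M ^ B = F ^ m W ^ B . 1_B *)
Definition MB_filt (m : nat) (q : M) : Prop :=
  exists2 w, WB_filt m w & q = lpi MB_kernel w.

Fact MB_filt0 m : MB_filt m 0.
Proof.
exists 0; last by rewrite raddf0.
split; last exact: submodule0.
by exists 0, 0; rewrite scale0r mul0r addr0.
Qed.
Fact MB_filtP m (c : k) p q : MB_filt m p -> MB_filt m q -> MB_filt m (c *: p + q).
Proof.
move=> [f [[a [u ->]] fm] ->] [g [[b [v ->]] gm] ->].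
exists (c *: (a *: (1 : V) + u * (X1 - 1)) + (b *: (1 : V) + v * (X1 - 1))).
  split; last exact: submoduleP.
  exists (c * a + b), (c *: u + v).
  by rewrite scalerDr scalerA addrACA -scalerDl mulrDl mscaleAl.
exact/esym/linearP.
Qed.
Fact MB_filt_decr m n : (m <= n)%N -> forall q, MB_filt n q -> MB_filt m q.
Proof.
move=> mn q [w [Ww wn] ->]; exists w => //; split=> //.
exact: filt_decr mn _ wn.
Qed.

Definition MB_filtration : filtration M :=
  Filtration (filt := fun m => Submodule (MB_filt0 m) (@MB_filtP m))
    MB_filt_decr.

(* The following lemmas show that - . 1_B maps F ^ m V ^ B to F ^ m M ^ B. *)
Definition B_aug (f : V) : Prop := exists c d, f = c * (X0 - 1) + d * (X1 - 1).

Lemma B_augD f g : B_aug f -> B_aug g -> B_aug (f + g).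
Proof.
move=> [c [d ->]] [c' [d' ->]]; exists (c + c'), (d + d').
by rewrite !mulrDl addrACA.
Qed.

Lemma B_augMl a f : B_aug f -> B_aug (a * f).
Proof.
by move=> [c [d ->]]; exists (a * c), (a * d); rewrite mulrDr !mulrA.
Qed.

Lemma B_aug_gen b : B_aug (monom 1 (F2_gen b) - 1).
Proof.
case: b; first by exists 0, 1; rewrite mul0r add0r mul1r.
by exists 1, 0; rewrite mul0r addr0 mul1r.
Qed.

Lemma B_aug_monom (x : F2) : B_aug (monom 1 x - 1).
Proof.
case: x => w; elim: w => [|[b e] w IH] rw.
  rewrite (_ : FreeGroup2 rw = 1%g) ?monom1 ?subrr; last exact: val_inj.
  by exists 0, 0; rewrite !mul0r addr0.
pose x : F2 := FreeGroup2 (reduced_behead rw).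
pose y : F2 := letter_eval F2_gen (b, e).
rewrite (_ : FreeGroup2 rw = (y * x)%g); last first.
  apply: val_inj; rewrite /y /letter_eval -[LHS](lconsE rw).
  by case: (e).
have -> : monom 1 (y * x)%g = monom 1 y * monom 1 x :> V.
  by rewrite monomM mul1r.
rewrite -(subrK (monom 1 y) (_ * _)) -addrA -{2}[monom 1 y]mulr1 -mulrBr.
apply: B_augD; first exact/B_augMl/IH.
rewrite /y /letter_eval; case: ifP => _; last exact: B_aug_gen.
set u := F2_gen _.
suff -> : monom 1 u^-1%g - 1 = - monom 1 u^-1%g * (monom 1 u - 1) :> V.
  exact/B_augMl/B_aug_gen.
by rewrite mulNr mulrBr monomM mulVg mulr1 mulr1 monom1 opprB.
Qed.

Lemma monoidAlg_map_unit (f : V) :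
  monoidAlg_map (fun=> tt) (monoidAlg_map F2_to_mu f) = monoidAlg_map (fun=> tt) f.
Proof.
rewrite [in RHS](monoidAlgE f) [monoidAlg_map F2_to_mu f]/monoidAlg_map !raddf_sum.
apply: eq_bigr => x _ /=.
by rewrite !monoidAlg_map_monom.
Qed.

Lemma B_aug_decomp (f : V) :
  exists2 g, B_aug g & f = mcoef (monoidAlg_map (fun=> tt) f) tt *: (1 : V) + g.
Proof.
exists (\sum_(x <- msupp f) mcoef f x *: (monom 1 x - 1)).
  apply: big_ind; first by exists 0, 0; rewrite !mul0r addr0.
    exact: B_augD.
  move=> x _; rewrite -[_ - _]mul1r mscaleAl.
  exact/B_augMl/B_aug_monom.
rewrite mcoef_sum scaler_suml -big_split {1}(monoidAlgE f).
apply: eq_bigr => x _; rewrite mcoef_monom eqxx /= -scalerDr addrC subrK.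
by rewrite -monomZ mulr1.
Qed.

Lemma B_ideal_aug f : B_ideal f -> B_aug f.
Proof.
move=> If; have [g Jg fE] := B_aug_decomp f.
by rewrite fE -monoidAlg_map_unit If raddf0 mcoef0 scale0r add0r.
Qed.

Lemma B_ideal_X1 : B_ideal (X1 - 1).
Proof.
rewrite /B_ideal raddfB /= -monom1 !monoidAlg_map_monom /F2_to_mu.
by rewrite F2_morphism_gen /F2_morphism subrr.
Qed.

Fact MB_filt_proj m f : VB_filtration m f -> MB_filtration m (lpi MB_kernel f).
Proof.
have W_X1 d : WB (d * (X1 - 1)) by exists 0, d; rewrite scale0r add0r.
case: m => [_|m [s [sI ->]]].
  have [g [c [d ->]] ->] := B_aug_decomp f; set e := mcoef _ _.
  exists (e *: (1 : V) + d * (X1 - 1)); first by split=> //; exists e, d.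
  by apply/lpiE; exists c; rewrite opprD addrACA subrr add0r addrK.
rewrite raddf_sum; apply: submodule_sum => p /sI[p1 /B_ideal_aug[c [d ->]]].
exists ((p.1 * d) * (X1 - 1)); last first.
  by apply/lpiE; exists (p.1 * c); rewrite mulrDr !mulrA addrK.
split=> //; exists [:: (p.1 * d, X1 - 1)]; rewrite big_seq1; split=> // q.
rewrite inE => /eqP -> /=; split; first exact: B_ideal_expMr.
exact: B_ideal_X1.
Qed.

(* The map induced by - . 1_B on the completions *)
Definition VB_hat_proj : completion VB_filtration -> completion MB_filtration :=
  completion_map MB_filt_proj.

End Betti.

Definition freeMonoid (A : choiceType) : Type := seq A.
HB.instance Definition _ (A : choiceType) := Choice.copy (freeMonoid A) (seq A).
HB.instance Definition _ (A : choiceType) :=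
  isMonoid.Build (freeMonoid A) (@catA A) (@cat0s A) (@cats0 A).

Section DeRham.
Context (k : comPzRingType) (gT : finGroupType).

(* [inl false], [inl true] and [inr g] stand for the generators e_0, e_1, g. *)
Definition DR_letter : choiceType := (bool + gT)%type.
Local Notation T := (monoidAlg k (freeMonoid DR_letter)).

Definition free_gen (a : DR_letter) : T := monom 1 [:: a].
Local Notation te0 := (free_gen (inl false)).
Local Notation tg g := (free_gen (inr g)).

Inductive DR_relator : T -> Prop :=
| DR_relator_mul g h : DR_relator (tg g * tg h - tg (g * h)%g)
| DR_relator_one : DR_relator (tg 1%g - 1)
| DR_relator_comm g : DR_relator (tg g * te0 - te0 * tg g).

(* The two-sided ideal generated by the relators *)
Definition DR_ideal (f : T) : Prop :=
  exists s : seq (T * T * T),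
    (forall p, p \in s -> DR_relator p.1.2)
    /\ f = \sum_(p <- s) p.1.1 * p.1.2 * p.2.

(* The degree of a word: e_0, e_1 have degree 1, the elements of G degree 0 *)
Definition DR_degree (w : freeMonoid DR_letter) : nat :=
  count (fun a : DR_letter => if a is inl _ then true else false) w.

(* The span of the words of degree at least m *)
Definition free_filt (m : nat) (f : T) : Prop :=
  forall w, mcoef f w != 0 -> (m <= DR_degree w)%N.

(* The graded algebra with the given presentation is T / DR_ideal; DR_filt m is
   the preimage in T of its part of degree at least m. The complete graded
   algebra is hence lim T / DR_filt m. *)
Definition DR_filt (m : nat) (f : T) : Prop :=
  exists a b, [/\ DR_ideal a, free_filt m b & f = a + b].

Lemma DR_idealD f g : DR_ideal f -> DR_ideal g -> DR_ideal (f + g).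
Proof.
move=> [s [sI ->]] [t [tI ->]]; exists (s ++ t); rewrite big_cat.
by split=> // p; rewrite mem_cat => /orP[/sI|/tI].
Qed.

Lemma DR_idealMl a f : DR_ideal f -> DR_ideal (a * f).
Proof.
move=> [s [sI ->]]; exists [seq (a * p.1.1, p.1.2, p.2) | p <- s]; split.
  by move=> _ /mapP[p /sI ? ->].
by rewrite big_map mulr_sumr; apply: eq_bigr => p _; rewrite !mulrA.
Qed.

Lemma DR_idealMr a f : DR_ideal f -> DR_ideal (f * a).
Proof.
move=> [s [sI ->]]; exists [seq (p.1.1, p.1.2, p.2 * a) | p <- s]; split.
  by move=> _ /mapP[p /sI ? ->].
by rewrite big_map mulr_suml; apply: eq_bigr => p _; rewrite !mulrA.
Qed.

Lemma free_filtD m f g : free_filt m f -> free_filt m g -> free_filt m (f + g).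
Proof.
move=> fm gm w; rewrite mcoefD; have [f0|f0 _] := eqVneq (mcoef f w) 0.
  by rewrite f0 add0r; apply: gm.
exact: fm.
Qed.

Lemma free_filt_sum m (I : Type) (r : seq I) (F : I -> T) :
  (forall i, free_filt m (F i)) -> free_filt m (\sum_(i <- r) F i).
Proof.
move=> Fm; apply: big_ind => //; last exact: free_filtD.
by move=> w; rewrite mcoef0 eqxx.
Qed.

Lemma DR_degreeM (v w : freeMonoid DR_letter) :
  DR_degree (v * w)%g = (DR_degree v + DR_degree w)%N.
Proof. exact: count_cat. Qed.

Lemma free_filtM m a f : free_filt m f -> free_filt m (a * f) /\ free_filt m (f * a).
Proof.
move=> fm; split; apply: free_filt_sum => v; apply: free_filt_sum => w u;
  rewrite mcoef_monom; case: (_ =P u) => [<- cn|_]; rewrite ?eqxx // DR_degreeM.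
  apply: leq_trans (leq_addl _ _); apply: fm; apply: contra cn => /eqP ->.
  by rewrite mulr0.
apply: leq_trans (leq_addr _ _); apply: fm; apply: contra cn => /eqP ->.
by rewrite mul0r.
Qed.

Fact DR_filtMl m a f : DR_filt m f -> DR_filt m (a * f).
Proof.
move=> [i [t [Ji tm ->]]]; exists (a * i), (a * t); rewrite mulrDr; split=> //.
  exact: DR_idealMl.
by have [] := free_filtM a tm.
Qed.

Fact DR_filtMr m a f : DR_filt m f -> DR_filt m (f * a).
Proof.
move=> [i [t [Ji tm ->]]]; exists (i * a), (t * a); rewrite mulrDl; split=> //.
  exact: DR_idealMr.
by have [] := free_filtM a tm.
Qed.

Fact DR_filt0 m : DR_filt m 0.
Proof.
exists 0, 0; rewrite addr0; split=> //; first by exists [::]; rewrite big_nil.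
by move=> w; rewrite mcoef0 eqxx.
Qed.

Fact DR_filtP m (c : k) f g : DR_filt m f -> DR_filt m g -> DR_filt m (c *: f + g).
Proof.
rewrite -[f]mul1r mscaleAl => /(DR_filtMl (c *: (1 : T))); rewrite mul1r.
move=> [i [t [Ji tm ->]]] [i' [t' [Ji' tm' ->]]]; exists (i + i'), (t + t').
by split; [apply: DR_idealD|apply: free_filtD|rewrite addrACA].
Qed.

Fact DR_filt_decr m n : (m <= n)%N -> forall f, DR_filt n f -> DR_filt m f.
Proof.
move=> mn f [i [t [Ji tn ->]]]; exists i, t; split=> // w /tn.
exact: leq_trans.
Qed.

Definition DR_filtration : ideal_filtration k (freeMonoid DR_letter) :=
  IdealFiltration
    (ideal_filt := Filtration
      (filt := fun m => Submodule (DR_filt0 m) (@DR_filtP m)) DR_filt_decr)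
    DR_filtMl DR_filtMr.

Local Notation V := (completion DR_filtration).

Definition DR_e0 : V := to_completion DR_filtration (free_gen (inl false)).
Definition DR_e1 : V := to_completion DR_filtration (free_gen (inl true)).
Definition DR_g (g : gT) : V := to_completion DR_filtration (free_gen (inr g)).

(* V e_0 + \sum_g V (g - 1) *)
Definition MDR_kernel_set (x : V) : Prop :=
  exists (a : V) (b : gT -> V), x = a * DR_e0 + \sum_(g : gT) b g * (DR_g g - 1).

Fact MDR_kernel0 : MDR_kernel_set 0.
Proof.
exists 0, (fun=> 0); rewrite mul0r add0r big1 // => g _.
by rewrite mul0r.
Qed.

Fact MDR_kernelP (c : k) x y :
  MDR_kernel_set x -> MDR_kernel_set y -> MDR_kernel_set (c *: x + y).
Proof.
move=> [a [b ->]] [a' [b' ->]]; exists (c *: a + a'), (fun g => c *: b g + b' g).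
rewrite scalerDr addrACA mulrDl cscaleAl scaler_sumr -big_split /=.
congr (_ + _); apply: eq_bigr => g _. by rewrite mulrDl -cscaleAl.
Qed.

Definition MDR_kernel : submodule V := Submodule MDR_kernel0 MDR_kernelP.

Definition MDR : Type := lquot MDR_kernel.
HB.instance Definition _ := Choice.on MDR.
HB.instance Definition _ := GRing.Lmodule.on MDR.

(* The projection - . 1_DR *)
Definition MDR_proj : V -> MDR := lpi MDR_kernel.
HB.instance Definition _ := GRing.Linear.on MDR_proj.

Definition MDR_open (U : set MDR) : Prop := open (MDR_proj @^-1` U).

Fact MDR_openT : MDR_open setT.
Proof. by rewrite /MDR_open preimage_setT; exact: openT. Qed.
Fact MDR_openI : setI_closed MDR_open.
Proof. by move=> A B; exact: openI. Qed.
Fact MDR_open_bigU (I : Type) (f : I -> set MDR) :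
  (forall i, MDR_open (f i)) -> MDR_open (\bigcup_i f i).
Proof. by move=> fo; apply: bigcup_open => i _; apply: fo. Qed.

(* The quotient topology; MDR_kernel is itself complete graded, so that this is
   the topology of the complete graded module. *)
HB.instance Definition _ :=
  isOpenTopological.Build MDR MDR_openT MDR_openI MDR_open_bigU.

End DeRham.

Section Exponential.
Context (k : comPzRingType) (alpha : {rmorphism rat -> k}).
Context (M : monoidType) (F : ideal_filtration k M).

(* The algebra k is a Q-algebra through alpha. *)
Definition completion_exp (x : completion F) : completion F :=
  lim ((fun n => \sum_(i < n) alpha (i`!%:R^-1) *: x ^+ i) @ \oo).
End Exponential.

Definition homeomorphism (X Y : topologicalType) (f : X -> Y) : Prop :=
  continuous f
  /\ exists g : Y -> X, [/\ cancel f g, cancel g f & continuous g].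

Notation VB_hat R k N := (completion (VB_filtration R k N)).
Notation MB_hat R k N := (completion (MB_filtration R k N)).
Notation VDR_hat k gT := (completion (DR_filtration k gT)).

Section IsoV.
Context (R : realType) (k : comPzRingType) (alpha : {rmorphism rat -> k}).
Context (gT : finGroupType) (N : nat) (iota : gT -> Cx R).

(* The preimage of exp (2 i pi / N) under iota; the default value 1 is not used
   when iota is an embedding of a cyclic group of order N. *)
Definition g_iota : gT := odflt 1%g [pick g | iota g == zeta_Cx R N].

(* f is a topological algebra isomorphism with X_0 |-> exp (e_0 / N) g_iota
   and X_1 |-> exp e_1. *)
Definition is_isoV (f : VB_hat R k N -> VDR_hat k gT) : Prop :=
  [/\ linear f, monoid_morphism f, homeomorphism f,
      f (to_completion (VB_filtration R k N) (X0 k)) =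
        completion_exp alpha (alpha (N%:R^-1) *: DR_e0 k gT) * DR_g k g_iota
    & f (to_completion (VB_filtration R k N) (X1 k)) =
        completion_exp alpha (DR_e1 k gT)].

End IsoV.

(* Main.v *)
Require Import Defs.
From HB Require Import structures.
From mathcomp Require Import all_boot all_order all_algebra all_fingroup.
From mathcomp Require Import cyclic all_classical all_reals topology.
From mathcomp Require Import generic_quotient finmap complex trigo ring lra.
Require Import Defs.

Set Implicit Arguments.
Unset Strict Implicit.
Unset Printing Implicit Defensive.

Import GRing.Theory Num.Theory.

Local Open Scope ring_scope.

(** Both modules are quotients, so iso^M exists, is bijective and is unique as
soon as iso^V carries the kernel of the Betti projection onto the kernel K of
the De Rham projection, and it is a homeomorphism if the Betti projection is a
quotient map as well. The proof has four ingredients.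

The Betti projection is onto and open ([completion_map_lift],
[completion_map_open]): it is induced by a map that sends each F^m V^B onto
F^m M^B, so a class in the completion is lifted term by term, as a convergent
series.

K is the left ideal generated by q - 1, where q = exp(e_0/N) g_iota is the image
of X_0 ([MDR_kernel_principal]). Write E = exp(e_0/N). Since e_0 commutes with
g_iota and g_iota^N = 1, one has q^N = E^N; and E^N - 1 = w e_0 where w is 1 in
degree 0, hence invertible. So e_0 is a left multiple of q^N - 1, hence of
q - 1, and g_iota - 1 is then one too. As g_iota generates G
([g_iota_generates]), this gives every g - 1. The converse inclusion is direct.

K is closed ([MDR_kernel_closed]). The relators and the generators e_0, g - 1
are homogeneous, so an element of K of degree at least m + 1 is a combination
of these generators with coefficients of degree at least m; a limit of elements
of K is thus a combination whose coefficients are convergent series.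

The kernel of the Betti projection contains the left multiples of X_0 - 1 and
each of its elements is a limit of such multiples. Through iso^V the multiples
fill K, and their limits stay in K because K is closed. This transfer replaces a
study of the intersections of the powers of I with k F_2 (X_0 - 1). *)

(** * Completions: series and induced maps *)

Lemma lpi_eq0 (k : pzRingType) (V : lmodType k) (S : submodule V) v :
  (lpi S v = 0) <-> S v.
Proof. by rewrite -(raddf0 (lpi S)) lpiE subr0. Qed.

Section Completion.
Context (k : pzRingType) (V : lmodType k) (F : filtration V).
Implicit Types x y : completion F.

Lemma coordD x y m : coord (x + y) m = coord x m + coord y m.
Proof. by []. Qed.

Lemma coordB x y m : coord (x - y) m = coord x m - coord y m.
Proof. by []. Qed.

Lemma coordZ c x m : coord (c *: x) m = c *: coord x m.
Proof. by []. Qed.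

Lemma coord_sum (I : Type) (r : seq I) (P : pred I) (u : I -> completion F) m :
  coord (\sum_(i <- r | P i) u i) m = \sum_(i <- r | P i) coord (u i) m.
Proof. by apply: (big_morph (fun x => coord x m)). Qed.

Lemma coord_eq_sub x y m : (coord x m = coord y m) <-> (coord (x - y) m = 0).
Proof. by rewrite coordB; split=> [->|/subr0_eq]; rewrite ?subrr. Qed.

Lemma coord_le0 x m n : (m <= n)%N -> coord x n = 0 -> coord x m = 0.
Proof. exact: (@coord_eq_le _ _ _ x 0). Qed.

Lemma to_completionD (u v : V) :
  to_completion F (u + v) = to_completion F u + to_completion F v.
Proof. exact: raddfD. Qed.

Lemma to_completionB (u v : V) :
  to_completion F (u - v) = to_completion F u - to_completion F v.
Proof. exact: raddfB. Qed.

Lemma to_completion_sum (I : Type) (r : seq I) (u : I -> V) :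
  to_completion F (\sum_(i <- r) u i) = \sum_(i <- r) to_completion F (u i).
Proof. exact: raddf_sum. Qed.

Lemma completion_hausdorff : hausdorff_space (completion F).
Proof.
move=> x y xy; apply: completionP => m.
have nb (z : completion F) :
    nbhs z [set t : completion F | coord t m = coord z m]%classic by exists m.
by have [z [/= <- <-]] := xy _ _ (nb x) (nb y).
Qed.

(** A series converges when its n-th term lies in the n-th step: modulo F m, only
the terms of index less than m remain. *)
Lemma csumP (u : nat -> completion F) : (forall n, coord (u n) n = 0) ->
  exists s : completion F, forall m, coord s m = coord (\sum_(i < m) u i) m.
Proof.
move=> u0; have sc m n : (m <= n)%N ->
    coord (\sum_(i < n) u i) m = coord (\sum_(i < m) u i) m.
  move=> /subnKC <-; elim: (n - m)%N => [|d IH]; first by rewrite addn0.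
  rewrite addnS big_ord_recr coordD IH /= (coord_le0 _ (u0 _)) ?addr0 //.
  exact: leq_addr.
suff c m n : (m <= n)%N ->
    lpi (F m) (repr (coord (\sum_(i < n) u i) n)) = coord (\sum_(i < m) u i) m.
  by exists (Completion c).
by move=> mn; rewrite coord_compat // sc.
Qed.

End Completion.

Section CompletionMap.
Context (k : pzRingType) (V W : lmodType k).
Context (F : filtration V) (G : filtration W) (f : {linear V -> W}).
Hypothesis fFG : forall m v, F m v -> G m (f v).

Lemma coord_map (x : completion F) m v : coord x m = lpi (F m) v ->
  coord (completion_map fFG x) m = lpi (G m) (f v).
Proof.
by move=> xv; apply/lpiE; rewrite -raddfB; apply: fFG; apply/lpiE; rewrite lpiK.
Qed.

Lemma completion_map_is_linear : linear (completion_map fFG).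
Proof.
move=> c x y; apply: completionP => m.
rewrite (@coord_map _ m (c *: repr (coord x m) + repr (coord y m))).
  by rewrite !linearP.
by rewrite raddfD /= linearZ /= !lpiK.
Qed.
HB.instance Definition _ :=
  GRing.isLinear.Build k (completion F) (completion G) *:%R (completion_map fFG)
    completion_map_is_linear.

Lemma coord_map_eq0 (x : completion F) m : coord x m = 0 ->
  coord (completion_map fFG x) m = 0.
Proof. by move=> x0; rewrite (coord_map (v := 0)) ?raddf0. Qed.

Lemma completion_map_continuous : continuous (completion_map fFG).
Proof.
move=> x A [m _ mA]; exists m => // y /= yx; apply: mA.
rewrite /mkset coord_eq_sub -raddfB.
exact/coord_map_eq0/(coord_eq_sub (F := F)).
Qed.

Hypothesis f_strict : forall m w, G m w -> exists2 v, F m v & f v = w.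

(** A class z is the sum of the differences of successive representatives; the
n-th difference lies in the step m + n, so it lifts there by strictness, and
the lifts form a convergent series. The shift by m yields a lift as close to 0
as z, which is openness at 0; surjectivity is the case m = 0. *)
Lemma completion_map_lift m (z : completion G) : coord z m = 0 ->
  exists2 y, coord y m = 0 & completion_map fFG y = z.
Proof.
move=> z0; pose zr n := repr (coord z (m + n)).
have zrE n : lpi (G (m + n)) (zr n) = coord z (m + n) by rewrite /zr lpiK.
have /f_strict[v0 v0F v0E] : G m (zr 0).
  by apply/lpi_eq0; rewrite /zr coord_compat ?leq_addr.
have /choice[v vP] n : exists v, F (m + n) v /\ f v = zr n.+1 - zr n.
  have /f_strict[v vF vE] : G (m + n) (zr n.+1 - zr n).
    by apply/lpiE; rewrite zrE /zr coord_compat // leq_add2l.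
  by exists v.
have vF n : F (m + n) (v n) by case: (vP n).
have [|s sE] := @csumP _ _ F (fun n => to_completion F (v n)).
  by move=> n; apply/lpi_eq0; apply: filt_decr (vF n); apply: leq_addl.
exists (to_completion F v0 + s).
  rewrite coordD sE coord_sum big1 ?addr0; first exact/lpi_eq0.
  by move=> i _; apply/lpi_eq0; apply: filt_decr (vF i); apply: leq_addr.
apply: completionP => n; rewrite (@coord_map _ n (v0 + \sum_(i < n) v i)).
  rewrite linearD v0E linear_sum /=.
  rewrite (eq_bigr (fun i : 'I_n => zr i.+1 - zr i)); last by move=> i _; case: (vP i).
  rewrite -(big_mkord xpredT (fun i => zr i.+1 - zr i)) telescope_sumr //.
  by rewrite addrC subrK /zr coord_compat // leq_addl.
by rewrite coordD sE coord_sum raddfD raddf_sum.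
Qed.

Lemma completion_map_open (A : set (completion F)) :
  open A -> open (completion_map fFG @` A)%classic.
Proof.
rewrite !openE => Ao _ [x Ax <-]; have [m _ mA] := Ao x Ax.
exists m => // z /= zx.
have [|y y0 yE] := @completion_map_lift m (z - completion_map fFG x).
  exact/coord_eq_sub.
exists (x + y); last by rewrite raddfD /= yE addrC subrK.
by apply: mA; rewrite /mkset coordD y0 addr0.
Qed.

End CompletionMap.

(** * Completed algebras: units and exponentials *)

Section CompletionAlgebra.
Context (k : comPzRingType) (M : monoidType) (F : ideal_filtration k M).
Implicit Types x y : completion F.

Lemma coordM x y m a b : coord x m = lpi (F m) a -> coord y m = lpi (F m) b ->
  coord (x * y) m = lpi (F m) (a * b).
Proof. by move=> xa yb; apply: lquot_mul; rewrite lpiK. Qed.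

Lemma coordMl x x' y m : coord x m = coord x' m ->
  coord (x * y) m = coord (x' * y) m.
Proof. by move=> e; apply: lquot_mul; rewrite ?e. Qed.

Lemma coordMr x y y' m : coord y m = coord y' m ->
  coord (x * y) m = coord (x * y') m.
Proof. by move=> e; apply: lquot_mul; rewrite ?e. Qed.

Hypothesis F_full : forall a, F 0%N a.
Hypothesis F_mul :
  forall m n a b, F m a -> F n b -> F (m + n)%N (a * b).

Lemma coordM0 x y m n : coord x m = 0 -> coord y n = 0 ->
  coord (x * y) (m + n) = 0.
Proof.
move=> x0 y0; apply/lpi_eq0; apply: F_mul; apply/lpi_eq0.
  by rewrite coord_compat ?leq_addr.
by rewrite coord_compat ?leq_addl.
Qed.

Lemma coordX0 x n : coord x 1 = 0 -> coord (x ^+ n) n = 0.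
Proof.
move=> x0; elim: n => [|n IH]; last by rewrite -addn1 exprD coordM0 // expr1.
by rewrite -[LHS]lpiK; apply/lpi_eq0/F_full.
Qed.

(** Geometric series in h = 1 - x. *)
Lemma completion_left_inverse x : coord x 1 = coord (1 : completion F) 1 ->
  exists y, y * x = 1.
Proof.
move=> x1; pose h := 1 - x.
have h0 : coord h 1 = 0 by apply/coord_eq_sub; rewrite x1.
have [s sE] := csumP (fun n => coordX0 n h0).
exists s; apply: completionP => m; rewrite (coordMl _ (sE m)).
have -> : x = 1 - h by rewrite opprB addrC subrK.
have -> : (\sum_(i < m) h ^+ i) * (1 - h) = 1 - h ^+ m.
  elim: m => [|m IH]; first by rewrite big_ord0 mul0r subrr.
  by rewrite big_ord_recr /= mulrDl IH mulrBr mulr1 -exprSr addrA subrK.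
by rewrite coordB coordX0 // subr0.
Qed.

Context (alpha : {rmorphism rat -> k}).

(** The series of (exp (c e) - 1) / e: its constant term is c, and it commutes
with whatever commutes with e because its partial sums do. *)
Lemma completion_expZE (c : k) (e : completion F) : coord e 1 = 0 ->
  exists u, [/\ completion_exp alpha (c *: e) = 1 + u * e,
    coord u 1 = coord (c *: (1 : completion F)) 1 & forall y, GRing.comm y e -> GRing.comm y u].
Proof.
move=> e0; pose t n : completion F := (alpha n.+1`!%:R^-1 * c ^+ n.+1) *: e ^+ n.
have t0 n : coord (t n) n = 0 by rewrite coordZ coordX0 // scaler0.
have [u uE] := csumP t0; exists u; split; last first.
- move=> y ye; apply: completionP => m.
  rewrite (coordMr _ (uE m)) (coordMl _ (uE m)) mulr_sumr mulr_suml.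
  congr (coord _ m); apply: eq_bigr => i _.
  by rewrite -cscaleAr -cscaleAl (commrX i ye).
- by rewrite uE big_ord1 /t factS fact0 invr1 rmorph1 mul1r expr1 expr0.
have eX n : (c *: e) ^+ n = c ^+ n *: e ^+ n.
  elim: n => [|n IH]; first by rewrite !expr0 scale1r.
  by rewrite !exprS IH -cscaleAl -cscaleAr scalerA.
apply: cvg_lim; first exact: completion_hausdorff.
move=> A [m _ mA]; exists m.+1 => // -[//|n] mn; apply: mA.
rewrite /mkset big_ord_recl fact0 invr1 rmorph1 expr0 scale1r !coordD.
congr (_ + _); rewrite (@coordMl u (\sum_(i < n) t i)); last first.
  by apply: (coord_eq_le (n := n)); [exact: mn|exact: uE].
rewrite mulr_suml; congr (coord _ m); apply: eq_bigr => i _.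
by rewrite lift0 eX scalerA -cscaleAl -exprSr.
Qed.

End CompletionAlgebra.

(** * Homogeneity and the closed kernel on the De Rham side *)

Section KerComb.
Context (A : pzRingType) (I : finType) (e : A) (y : I -> A).
Implicit Types (a : A) (b : I -> A).

(** This shape is that of the elements of the kernel of the De Rham projection,
with e = e_0 and y g = g - 1, in the free algebra and in its completion. *)
Definition ker_comb (a : A) (b : I -> A) : A :=
  a * e + \sum_i b i * y i.

Lemma ker_combB a a' b b' :
  ker_comb a b - ker_comb a' b' =
  ker_comb (a - a') (fun i => b i - b' i).
Proof.
rewrite /ker_comb opprD addrACA -mulrBl -sumrB; congr (_ + _).
by apply: eq_bigr => g _; rewrite mulrBl.
Qed.

Lemma ker_combD a a' b b' :
  ker_comb a b + ker_comb a' b' =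
  ker_comb (a + a') (fun i => b i + b' i).
Proof.
rewrite /ker_comb addrACA -mulrDl -big_split; congr (_ + _).
by apply: eq_bigr => g _; rewrite mulrDl.
Qed.

Lemma ker_comb_sum n (a : nat -> A) (b : nat -> I -> A) :
  ker_comb (\sum_(i < n) a i) (fun j => \sum_(i < n) b i j) =
  \sum_(i < n) ker_comb (a i) (b i).
Proof.
rewrite /ker_comb big_split /= mulr_suml exchange_big /=; congr (_ + _).
by apply: eq_bigr => g _; rewrite mulr_suml.
Qed.

End KerComb.

Section DeRhamGrading.
Context (k : comPzRingType) (gT : finGroupType).
Local Arguments DR_filtration : simpl never.
Local Notation T := (monoidAlg k (freeMonoid (DR_letter gT))).
Local Notation DRF := (DR_filtration k gT).
Local Notation V := (completion DRF).
Local Notation te0 := (free_gen k (inl false : DR_letter gT)).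
Local Notation tg g := (free_gen k (inr g : DR_letter gT)).
Implicit Types (a f r y : T) (g h : gT).

Lemma DR_ideal0 : DR_ideal (0 : T).
Proof. by exists [::]; rewrite big_nil. Qed.

Lemma DR_ideal_sum (I : Type) (s : seq I) (f : I -> T) :
  (forall i, DR_ideal (f i)) -> DR_ideal (\sum_(i <- s) f i).
Proof. by move=> fI; apply: big_ind => //; [exact: DR_ideal0|exact: DR_idealD]. Qed.

Lemma free_filt0 m : free_filt m (0 : T).
Proof. by move=> w; rewrite mcoef0 eqxx. Qed.

Lemma DR_ideal_filt m a : DR_ideal a -> DR_filt m a.
Proof. by move=> Ia; exists a, 0; rewrite addr0; split=> //; apply: free_filt0. Qed.

Lemma free_DR_filt m a : free_filt m a -> DR_filt m a.
Proof. by move=> am; exists 0, a; rewrite add0r; split=> //; apply: DR_ideal0. Qed.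

Lemma DR_filt_full a : DRF 0 a.
Proof. exact: (@free_DR_filt 0 a (fun w _ => leq0n _)). Qed.

Lemma free_filt_mul m n a b : free_filt m a -> free_filt n b ->
  free_filt (m + n) (a * b).
Proof.
move=> am bn; apply: free_filt_sum => v; apply: free_filt_sum => w u.
rewrite mcoef_monom; case: (_ =P u) => [<- cn|_]; rewrite ?eqxx // DR_degreeM.
by apply: leq_add; [apply: am|apply: bn]; apply: contra cn => /eqP ->;
  rewrite ?mul0r ?mulr0.
Qed.

Lemma DR_filt_mul m n a b : DRF m a -> DRF n b -> DRF (m + n)%N (a * b).
Proof.
move=> [i [t [Ii tm ->]]] [j [s [Ij sn ->]]].
exists (i * (j + s) + t * j), (t * s); split.
- by apply: DR_idealD; [apply: DR_idealMr|apply: DR_idealMl].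
- exact: free_filt_mul.
- by rewrite mulrDl [t * (j + s)]mulrDr addrA.
Qed.

Definition trunc (n : nat) (f : T) : T :=
  [fsfun w in msupp f => if (DR_degree w < n)%N then mcoef f w else 0].

Lemma mcoef_trunc n f w :
  mcoef (trunc n f) w = if (DR_degree w < n)%N then mcoef f w else 0.
Proof.
rewrite {1}/mcoef fsfunE; case: ifPn => // /mcoef_out ->.
by case: ifP.
Qed.

Lemma trunc_is_linear n : linear (trunc n).
Proof.
move=> c f1 f2; apply: mcoefP => w; rewrite !(mcoef_trunc, mcoefD, mcoefZ).
by case: ifP; rewrite ?mulr0 ?addr0.
Qed.
HB.instance Definition _ n :=
  GRing.isLinear.Build k T T *:%R (trunc n) (trunc_is_linear n).

Lemma truncD n f1 f2 : trunc n (f1 + f2) = trunc n f1 + trunc n f2.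
Proof. exact: raddfD. Qed.

Lemma trunc_sum n (I : Type) (s : seq I) (f : I -> T) :
  trunc n (\sum_(i <- s) f i) = \sum_(i <- s) trunc n (f i).
Proof. exact: raddf_sum. Qed.

Lemma trunc_filt n f : free_filt n f -> trunc n f = 0.
Proof.
move=> fn; apply: mcoefP => w; rewrite mcoef_trunc mcoef0.
case: ltnP => // wn; apply/eqP/contraT => /fn; by rewrite leqNgt wn.
Qed.

Lemma filt_sub_trunc n f : free_filt n (f - trunc n f).
Proof.
move=> w; rewrite mcoefD mcoefN mcoef_trunc.
by case: ltnP => // _; rewrite subrr eqxx.
Qed.

Definition homog (d : nat) f := forall w, mcoef f w != 0 -> DR_degree w = d.

Lemma homog_filt d f : homog d f -> free_filt d f.
Proof. by move=> fd w /fd ->. Qed.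

Lemma homog_monom (c : k) (w : freeMonoid (DR_letter gT)) :
  homog (DR_degree w) (monom c w).
Proof. by move=> v; rewrite mcoef_monom; case: (w =P v) => [->//|_]; rewrite eqxx. Qed.

Lemma homogD d f1 f2 : homog d f1 -> homog d f2 -> homog d (f1 + f2).
Proof.
move=> h1 h2 w; rewrite mcoefD; have [->|/h1 -> //] := eqVneq (mcoef f1 w) 0.
by rewrite add0r => /h2.
Qed.

Lemma homogN d f : homog d f -> homog d (- f).
Proof. by move=> h w; rewrite mcoefN oppr_eq0 => /h. Qed.

Lemma homog_sum d (I : Type) (s : seq I) (f : I -> T) :
  (forall i, homog d (f i)) -> homog d (\sum_(i <- s) f i).
Proof.
move=> fd; apply: big_ind => //; last exact: homogD.
by move=> w; rewrite mcoef0 eqxx.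
Qed.

Lemma homogM d e f1 f2 : homog d f1 -> homog e f2 -> homog (d + e) (f1 * f2).
Proof.
move=> h1 h2; apply: homog_sum => v; apply: homog_sum => w u.
rewrite mcoef_monom; case: (_ =P u) => [<- cn|_]; rewrite ?eqxx // DR_degreeM.
congr (_ + _)%N; [apply: h1|apply: h2]; apply: contra cn => /eqP ->.
  by rewrite mul0r.
by rewrite mulr0.
Qed.

Lemma trunc_homog n d f : homog d f -> trunc n f = if (d < n)%N then f else 0.
Proof.
move=> fd; apply: mcoefP => w; rewrite mcoef_trunc.
have [w0|/fd -> //] := eqVneq (mcoef f w) 0; last by case: ifP; rewrite ?mcoef0.
by rewrite w0; do 2!case: ifP => // _; rewrite ?w0 ?mcoef0.
Qed.

(** Linear in a, hence a matter of monomials. For n < e both sides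
vanish, as n - e is then 0 and nothing has degree less than 0. *)
Lemma trunc_mulr n e a y : homog e y -> trunc n (a * y) = trunc (n - e) a * y.
Proof.
move=> ye; rewrite (monoidAlgE a) mulr_suml !raddf_sum mulr_suml.
apply: eq_bigr => w _ /=.
have we := homogM (@homog_monom (mcoef a w) w) ye.
rewrite (trunc_homog _ we) (trunc_homog _ (@homog_monom _ w)) ltn_subRL addnC.
by case: ifP; rewrite ?mul0r.
Qed.

Lemma homog_e0 : homog 1 te0. Proof. exact: homog_monom. Qed.
Lemma homog_g g : homog 0 (tg g). Proof. exact: homog_monom. Qed.
Lemma homog_1 : homog 0 (1 : T).
Proof. exact: (@homog_monom 1 1%g). Qed.

Lemma homog_g1 g : homog 0 (tg g - 1).
Proof. by apply: homogD; [exact: homog_g|apply/homogN/homog_1]. Qed.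

Lemma homog_relator r : DR_relator r -> exists d, homog d r.
Proof.
case=> [g h||g].
- exists 0%N; apply: homogD; last exact/homogN/homog_g.
  exact: (homogM (@homog_g g) (@homog_g h)).
- exists 0%N; exact: homog_g1.
- exists 1%N; apply: homogD; first exact: (homogM (@homog_g g) (@homog_e0)).
  exact/homogN/(homogM (@homog_e0) (@homog_g g)).
Qed.

(** Each relator is homogeneous, so that the ideal of relations is graded. *)
Lemma trunc_ideal n f : DR_ideal f -> DR_ideal (trunc n f).
Proof.
move=> [s [sI ->]]; rewrite raddf_sum big_seq.
apply: big_ind => [||p /sI rel /=]; [exact: DR_ideal0|exact: DR_idealD|].
have [d hd] := homog_relator rel.
rewrite (monoidAlgE p.2) mulr_sumr raddf_sum.
apply: DR_ideal_sum => w /=; rewrite -mulrA.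
rewrite (trunc_mulr _ _ (homogM hd (@homog_monom _ w))).
by rewrite mulrA; exists [:: (trunc (n - (d + DR_degree w)) p.1.1, p.1.2,
  monom (mcoef p.2 w) w)]; rewrite big_seq1; split=> // q; rewrite inE => /eqP ->.
Qed.

Lemma trunc_DR_filt n f : DR_filt n f -> DR_ideal (trunc n f).
Proof.
move=> [a [b [Ia bn ->]]]; rewrite raddfD /= (trunc_filt bn) addr0.
exact: trunc_ideal.
Qed.

Local Notation tcomb := (ker_comb te0 (fun g => tg g - 1)).
Local Notation vcomb := (ker_comb (DR_e0 k gT) (fun g => DR_g k g - 1)).

Lemma to_completion_comb a (b : gT -> T) : to_completion DRF (tcomb a b) =
  vcomb (to_completion DRF a) (fun g => to_completion DRF (b g)).
Proof.
rewrite /ker_comb to_completionD to_completionM to_completion_sum; congr (_ + _).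
by apply: eq_bigr => g _; rewrite to_completionM to_completionB.
Qed.

Lemma coord_comb m (a a' : V) (b b' : gT -> V) : coord a m = coord a' m ->
  (forall g, coord (b g) m = coord (b' g) m) ->
  coord (vcomb a b) m = coord (vcomb a' b') m.
Proof.
move=> aa' bb'; rewrite /ker_comb !coordD !coord_sum (coordMl _ aa').
by congr (_ + _); apply: eq_bigr => g _; apply: coordMl.
Qed.

(** A combination of degree at least m + 1 can be written, modulo the relations,
with coefficients of degree at least m: removing from the coefficients their
part of low degree removes exactly the truncation of the combination, which
lies in the ideal of relations. The coefficient of e_0 loses one degree. *)
Lemma tcomb_strict m a (b : gT -> T) : DR_filt m.+1 (tcomb a b) ->
  exists a' (b' : gT -> T), [/\ DR_filt m a', forall g, DR_filt m (b' g)
    & DR_ideal (tcomb a b - tcomb a' b')].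
Proof.
move=> ab; exists (a - trunc m a), (fun g => b g - trunc m.+1 (b g)); split.
- exact/free_DR_filt/filt_sub_trunc.
- move=> g; apply: (DR_filt_decr (leqnSn m)).
  exact/free_DR_filt/filt_sub_trunc.
suff -> : tcomb a b - tcomb (a - trunc m a) (fun g => b g - trunc m.+1 (b g)) =
    trunc m.+1 (tcomb a b) by apply: trunc_DR_filt.
rewrite ker_combB /ker_comb truncD (trunc_mulr _ _ (@homog_e0)) trunc_sum subSS subn0.
rewrite subKr; congr (_ + _); apply: eq_bigr => g _.
by rewrite (trunc_mulr _ _ (@homog_g1 g)) subn0 subKr.
Qed.

(** Approximate x by combinations p n, modulo degree n. Two successive ones differ
in degree at least n, so their difference has coefficients r of large degree;
the coefficients of x are those of p 1 plus the sums of the series of these r. *)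
Lemma MDR_kernel_closed (x : V) :
  (forall m, exists2 y, MDR_kernel k gT y & coord x m = coord y m) ->
  MDR_kernel k gT x.
Proof.
move=> xK; have /choice[p pE] m : exists p : T * (gT -> T),
    coord x m = lpi (DRF m) (tcomb p.1 p.2).
  have [_ [a [b ->]] ->] := xK m.
  exists (repr (coord a m), fun g => repr (coord (b g) m)).
  transitivity (coord (to_completion DRF
      (tcomb (repr (coord a m)) (fun g => repr (coord (b g) m)))) m) => //.
  rewrite to_completion_comb; apply: coord_comb => [|g] /=; by rewrite lpiK.
(* The indices are shifted by one because strictness loses one degree. *)
pose q n := tcomb (p n).1 (p n).2.
have qE n : lpi (DRF n) (q n) = coord x n by rewrite pE.
have /choice[r rP] n : exists r : T * (gT -> T), [/\ DRF n r.1,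
    forall g, DRF n (r.2 g) & DR_ideal (q n.+2 - q n.+1 - tcomb r.1 r.2)].
  have : DRF n.+1 (q n.+2 - q n.+1).
    apply/lpiE; rewrite [RHS]qE -(coord_compat x (leqnSn n.+1)) -qE.
    by rewrite lpi_repr.
  rewrite ker_combB => /tcomb_strict[a' [b' [aF bF abI]]].
  by exists (a', b').
have [|a aE] := @csumP _ _ DRF (fun n => to_completion DRF (r n).1).
  by move=> n; apply/lpi_eq0; case: (rP n).
have /choice[b bE] g : exists b : V, forall m,
    coord b m = coord (\sum_(n < m) to_completion DRF ((r n).2 g)) m.
  apply: (@csumP _ _ DRF (fun n => to_completion DRF ((r n).2 g))) => n.
  by apply/lpi_eq0; case: (rP n).
exists (to_completion DRF (p 1).1 + a),
  (fun g => to_completion DRF ((p 1).2 g) + b g).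
apply: completionP => m.
rewrite -/(ker_comb _ _ _ _) -ker_combD coordD -to_completion_comb.
rewrite (coord_comb (aE m) (bE^~ m)).
rewrite (ker_comb_sum _ _ m (fun n => to_completion DRF (r n).1)
  (fun n g => to_completion DRF ((r n).2 g))) -coordD.
under eq_bigr do rewrite -to_completion_comb.
rewrite -to_completion_sum -to_completionD.
transitivity (lpi (DRF m) (q m.+1)).
  by rewrite -(coord_compat x (leqnSn m)) -qE lpi_repr.
apply/lpiE.
have -> : q m.+1 = q 1 + \sum_(i < m) (q i.+2 - q i.+1).
  rewrite -(big_mkord xpredT (fun i => q i.+2 - q i.+1)).
  by rewrite (telescope_sumr (fun i => q i.+1)) // addrC subrK.
rewrite opprD addrACA subrr add0r -sumrB.
apply: DR_ideal_filt; apply: DR_ideal_sum => i; by case: (rP i).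
Qed.

End DeRhamGrading.

(** * Roots of unity *)

Lemma card_group_gt0 (gT : finGroupType) : (0 < #|[set: gT]%SET|)%N.
Proof. exact: (cardG_gt0 [set: gT]%G). Qed.

Lemma expg_card_setT (gT : finGroupType) (g : gT) :
  (g ^+ #|[set: gT]%SET|)%g = 1%g.
Proof. by apply: (@expg_cardG gT [set: gT]%G); rewrite inE. Qed.

Section RootsOfUnity.
Context (R : realType) (gT : finGroupType) (iota : gT -> Cx R).
Hypothesis iotaM : {morph iota : g h / (g * h)%g}.
Hypothesis iota_inj : injective iota.
Local Notation N := #|[set: gT]%SET|.

Lemma Cx_valX (z : Cx R) n : Cx_val (z ^+ n)%g = Cx_val z ^+ n.
Proof. by elim: n => // n IH; rewrite expgS exprS -IH. Qed.

Lemma iota1 : iota 1%g = 1%g.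
Proof. by apply: (mulgI (iota 1%g)); rewrite -iotaM !mulg1. Qed.

Lemma iotaX g n : iota (g ^+ n)%g = (iota g ^+ n)%g.
Proof. by elim: n => [|n IH]; rewrite ?iota1 // !expgS iotaM IH. Qed.

(** The image of iota consists of #|G| roots of unity of order dividing #|G|; a
field has no more of them, so exp (2 i pi / N) is in the image and the default
value of g_iota is not taken. *)
Lemma iota_g_iota : iota (g_iota N iota) = zeta_Cx R N.
Proof.
rewrite /g_iota; case: pickP => [g /eqP //|no].
pose s := zeta_Cx R N :: [seq iota g | g <- enum gT].
have : (size (map (@Cx_val R) s) <= N)%N.
  apply: (max_unity_roots (card_group_gt0 gT)).
    apply/allP => _ /mapP[z zs ->]; apply/unity_rootP.
    rewrite -Cx_valX (_ : (z ^+ N)%g = 1%g) //.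
    move: zs; rewrite inE => /predU1P[->|/mapP[g _ ->]]; first exact/eqP/zetaC_mu.
    by rewrite -iotaX expg_card_setT iota1.
  rewrite map_inj_uniq; last exact: val_inj.
  rewrite /= (map_inj_uniq iota_inj) enum_uniq andbT.
  by apply/mapP => -[g _ zg]; have := no g; rewrite zg eqxx.
by rewrite size_map /= size_map -cardE cardsT ltnn.
Qed.

(** With t = pi j / n, the equality cos (2 t) = 1 forces sin t = 0, whereas sin is
positive on ]0, pi[. *)
Lemma zeta_primitive n j : (0 < j < n)%N -> (zeta_Cx R n ^+ j)%g <> 1%g.
Proof.
move=> /andP[j0 jn] /(congr1 (@Cx_val R)); rewrite Cx_valX deMoivre => -[].
have n0 : (n%:R : R) != 0 by rewrite pnatr_eq0 -lt0n (ltn_trans j0).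
set t : R := pi * j%:R / n%:R.
have -> : 2 * pi / n%:R *+ j = t + t.
  by rewrite -mulr_natr /t; field.
have n_gt0 : (0 : R) < n%:R by rewrite ltr0n (ltn_trans j0).
have t0 : 0 < t < pi.
  rewrite /t divr_gt0 ?mulr_gt0 ?pi_gt0 //= ?ltr0n //.
  by rewrite ltr_pdivrMr // ltr_pM2l ?pi_gt0 // ltr_nat.
have := sin_gt0_pi t0; rewrite cosD => st0 ct _.
have := cos2Dsin2 t; nra.
Qed.

Lemma g_iota_generates g : exists j, g = (g_iota N iota ^+ j)%g.
Proof.
set z := g_iota N iota.
have oz : #[z]%g = N.
  apply/eqP; rewrite eqn_leq subset_leq_card ?finset.subsetT //= leqNgt; apply/negP => oz.
  apply: (@zeta_primitive N #[z]%g); first by rewrite order_gt0.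
  by rewrite -iota_g_iota -iotaX expg_order iota1.
have zT : <[z]>%g = [set: gT]%SET.
  by apply/eqP; rewrite eqEcard finset.subsetT -oz /=.
by apply/cycleP; rewrite zT inE.
Qed.

End RootsOfUnity.

(** * The De Rham kernel is generated by one element *)

Section DeRhamKernel.
Context (k : comPzRingType) (alpha : {rmorphism rat -> k}) (gT : finGroupType).
Local Arguments DR_filtration : simpl never.
Local Notation DRF := (DR_filtration k gT).
Local Notation V := (completion DRF).
Local Notation e0 := (DR_e0 k gT).
Local Notation G := (@DR_g k gT).
Local Notation K := (MDR_kernel k gT).
Local Notation N := #|[set: gT]%SET|.
Implicit Types (x y c : V) (g h : gT).

Lemma to_completion_DR_eq a b : DR_ideal (a - b) ->
  to_completion DRF a = to_completion DRF b.
Proof. by move=> Iab; apply: completionP => m; apply/lpiE/DR_ideal_filt. Qed.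

Lemma DR_ideal_relator r : @DR_relator k gT r -> DR_ideal r.
Proof.
move=> rr; exists [:: (1, r, 1)]; rewrite big_seq1 mul1r mulr1; split=> // p.
by rewrite inE => /eqP ->.
Qed.

Lemma DR_gM g h : G (g * h)%g = G g * G h.
Proof.
rewrite /DR_g -to_completionM; apply/esym/to_completion_DR_eq.
exact/DR_ideal_relator/DR_relator_mul.
Qed.

Lemma DR_g1 : G 1%g = 1.
Proof. exact/to_completion_DR_eq/DR_ideal_relator/DR_relator_one. Qed.

Lemma DR_gX g n : G (g ^+ n)%g = G g ^+ n.
Proof. by elim: n => [|n IH]; rewrite ?DR_g1 // expgS exprS DR_gM IH. Qed.

Lemma DR_g_e0 g : GRing.comm (G g) e0.
Proof.
rewrite /GRing.comm -!to_completionM; apply: to_completion_DR_eq.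
exact/DR_ideal_relator/DR_relator_comm.
Qed.

Lemma coord_e0 : coord e0 1 = 0.
Proof. exact/lpi_eq0/free_DR_filt/homog_filt/homog_e0. Qed.

Lemma MDR_kernelMl c x : K x -> K (c * x).
Proof.
move=> [a [b ->]]; exists (c * a), (fun g => c * b g).
rewrite mulrDr mulrA mulr_sumr; congr (_ + _).
by apply: eq_bigr => g _; rewrite mulrA.
Qed.

Lemma MDR_kernel_e0 : K e0.
Proof.
by exists 1, (fun=> 0); rewrite mul1r big1 ?addr0 // => g _; rewrite mul0r.
Qed.

Lemma MDR_kernel_g g : K (G g - 1).
Proof.
exists 0, (fun h => if h == g then 1 else 0); rewrite mul0r add0r.
rewrite (bigD1 g) //= eqxx mul1r big1 ?addr0 // => h /negbTE ->.
by rewrite mul0r.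
Qed.

Section Generator.
Context (z : gT) (z_gen : forall g, exists j, g = (z ^+ j)%g).
Local Notation q := (completion_exp alpha (alpha N%:R^-1 *: e0) * G z).

Lemma MDR_kernel_q1 : K (q - 1).
Proof.
have [u [-> _ _]] := completion_expZE (@DR_filt_full k gT) (@DR_filt_mul k gT) alpha
  (alpha N%:R^-1) coord_e0.
rewrite mulrDl mul1r -mulrA -DR_g_e0 mulrA addrAC addrC.
apply: (submoduleD (S := K)); last exact: MDR_kernel_g.
exact/MDR_kernelMl/MDR_kernel_e0.
Qed.

(** With E = exp (e_0 / N) = 1 + u e_0 and s the sum of the E^i for i < N, the
powers give q^N - 1 = E^N - 1 = u s e_0. In degree 0 the factor u is 1 / N and s
is N, so that u s is invertible. *)
Lemma e0_q1 : exists c, e0 = c * (q - 1).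
Proof.
have [u [EE u1 uC]] := completion_expZE (@DR_filt_full k gT) (@DR_filt_mul k gT) alpha
  (alpha N%:R^-1) coord_e0.
rewrite EE; set E := 1 + u * e0.
have Esub : E - 1 = u * e0 by rewrite /E addrAC subrr add0r.
have commE y : GRing.comm y e0 -> GRing.comm y E.
  move=> ye; apply: commrD; first exact: commr1.
  by apply: commrM => //; apply: uC.
pose s := \sum_(i < N) E ^+ i.
have se0 : e0 * s = s * e0.
  apply: commr_sum => i _; apply: commrX; exact: commE.
have ENE : E ^+ N - 1 = u * s * e0.
  by rewrite subrX1 Esub -/s -[LHS]mulrA se0 mulrA.
have qN : (E * G z) ^+ N = E ^+ N.
  rewrite exprMn_comm; last exact/commr_sym/commE/DR_g_e0.
  by rewrite -DR_gX expg_card_setT DR_g1 mulr1.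
have E1 : coord E 1 = coord (1 : V) 1.
  apply/coord_eq_sub; rewrite Esub.
  by rewrite (coordMr _ (_ : _ = coord (0 : V) 1)) ?mulr0 // coord_e0.
have s1 : coord s 1 = coord (N%:R : V) 1.
  rewrite -[X in X%:R]card_ord -sumr_const !coord_sum.
  apply: eq_bigr => i _; elim: (nat_of_ord i) => [|j IH]; first by rewrite expr0.
  by rewrite exprS (coordMl _ E1) mul1r.
have [|w wE] := completion_left_inverse (@DR_filt_full k gT) (@DR_filt_mul k gT) (x := u * s).
  rewrite (coordMl _ u1) (coordMr _ s1) mulr_natr scalerMnl -rmorphMn.
  rewrite -mulr_natr mulVf ?rmorph1 ?scale1r //.
  by rewrite Num.Theory.pnatr_eq0 -lt0n card_group_gt0.
exists (w * \sum_(i < N) (E * G z) ^+ i).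
have qsC : GRing.comm (E * G z - 1) (\sum_(i < N) (E * G z) ^+ i).
  apply: commr_sum => i _; apply: commrX; apply/commr_sym/commrB => //.
  exact: commr1.
by rewrite -mulrA -qsC -subrX1 qN ENE [RHS]mulrA wE mul1r.
Qed.

Lemma MDR_kernel_principal x : K x <-> exists c, x = c * (q - 1).
Proof.
split=> [|[c ->]]; last exact/MDR_kernelMl/MDR_kernel_q1.
pose P y := exists c, y = c * (q - 1).
have PD y y' : P y -> P y' -> P (y + y').
  by move=> [c ->] [c' ->]; exists (c + c'); rewrite mulrDl.
have PM c y : P y -> P (c * y).
  by move=> [c' ->]; exists (c * c'); rewrite mulrA.
have Pe0 : P e0 by apply: e0_q1.
have Pz : P (G z - 1).
  have [u [EE _ _]] := completion_expZE (@DR_filt_full k gT) (@DR_filt_mul k gT) alpha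
    (alpha N%:R^-1) coord_e0.
  (* q = E z = z + u e_0 z, and e_0 commutes with z. *)
  have -> : G z - 1 = (q - 1) + - (u * G z) * e0.
    by rewrite EE mulrDl mul1r mulNr -!mulrA DR_g_e0 addrAC addrK.
  by apply/PD/PM/Pe0; exists 1; rewrite mul1r.
have Pg g : P (G g - 1).
  have [j ->] := z_gen g; rewrite DR_gX subrX1.
  have C : GRing.comm (G z - 1) (\sum_(i < j) G z ^+ i).
    apply: commr_sum => i _; apply: commrX; apply/commr_sym/commrB => //.
    exact: commr1.
  by rewrite C; apply: PM.
move=> [a [b ->]]; apply: (PD); first exact: PM.
apply: big_ind => [|y y'|g _]; [|exact: PD|exact: PM].
by exists 0; rewrite mul0r.
Qed.

End Generator.
End DeRhamKernel.

(** * The Betti projection *)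

Section BettiProjection.
Context (R : realType) (k : comPzRingType) (N : nat).
Local Arguments VB_filtration : simpl never.
Local Arguments MB_filtration : simpl never.
Local Notation VBF := (VB_filtration R k N).
Local Notation MBF := (MB_filtration R k N).
Local Notation V := (completion VBF).
Local Notation x0 := (to_completion VBF (X0 k)).
Local Notation proj := (@VB_hat_proj R k N).

Lemma MB_filt_strict m w : MBF m w ->
  exists2 v, VBF m v & lpi (MB_kernel k) v = w.
Proof. by move=> [v [_ vF] ->]; exists v. Qed.

Lemma VB_hat_proj_linear : linear proj.
Proof. exact: completion_map_is_linear. Qed.

Lemma VB_hat_proj_surj z : exists x, proj x = z.
Proof.
have [|x _ <-] := completion_map_lift (@MB_filt_proj R k N) MB_filt_strict
  (m := 0) (z := z); last by exists x.
rewrite -[LHS]lpiK; apply/lpi_eq0.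
rewrite -[X in MBF 0%N X]lpiK; exact: MB_filt_proj.
Qed.

(** The kernel is the closure of the left ideal generated by X_0 - 1; this
holds because F ^ m M is the image of a part of F ^ m V. *)
Lemma VB_hat_proj_eq0 (x : V) : proj x = 0 <->
  forall m, exists a, coord x m = lpi (VBF m) (a * (X0 k - 1)).
Proof.
split=> [px m|xa].
  have := coord_map (@MB_filt_proj R k N) (esym (lpiK (coord x m))).
  rewrite -/(proj x) px => /esym /lpi_eq0 [w [_ wF] /lpiE[a aE]].
  exists a; rewrite -aE -[LHS]lpiK; apply/lpiE.
  by rewrite opprB addrC subrK.
apply: completionP => m; have [a /coord_map-> ] := xa m.
have ker0 : lpi (MB_kernel k) (a * (X0 k - 1)) = 0 by apply/lpi_eq0; exists a.
by apply/lpi_eq0; rewrite [X in MBF m X]ker0; apply: submodule0.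
Qed.

Lemma VB_hat_proj_X0 (c : V) : proj (c * (x0 - 1)) = 0.
Proof.
apply/VB_hat_proj_eq0 => m; exists (repr (coord c m)).
by apply: coordM; rewrite ?lpiK // -to_completionB.
Qed.

Lemma VB_hat_proj_eq0_approx (x : V) m : proj x = 0 ->
  exists c, coord x m = coord (c * (x0 - 1)) m.
Proof.
move=> /VB_hat_proj_eq0 /(_ m)[a ->]; exists (to_completion VBF a).
by apply/esym/coordM; rewrite // -to_completionB.
Qed.

End BettiProjection.

(** * The induced isomorphism *)

Lemma MDR_openE (k : comPzRingType) (gT : finGroupType) (U : set (MDR k gT)) :
  open U = open (@MDR_proj k gT @^-1` U)%classic.
Proof. by []. Qed.

Theorem mainTheorem9 (R : realType) (k : comPzRingType)
    (alpha : {rmorphism rat -> k})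
    (gT : finGroupType) (N : nat)
    (cycG : cyclic [set: gT]%SET) (oG : #|[set: gT]%SET| = N)
    (iota : gT -> Cx R)
    (iotaM : {morph iota : g h / (g * h)%g}) (iota_inj : injective iota)
    (isoV : VB_hat R k N -> VDR_hat k gT)
    (isoVP : is_isoV alpha iota isoV) :
  exists! isoM : MB_hat R k N -> MDR k gT,
    [/\ linear isoM, homeomorphism isoM &
        isoM \o @VB_hat_proj R k N = @MDR_proj k gT \o isoV].
Proof.
subst N; set N := #|[set: gT]%SET| in isoV isoVP *.
case: isoVP => fP [f1 fM] [fC [f' [fK f'K f'C]]] fX0 _.
set p := @VB_hat_proj R k N; set p' := @MDR_proj k gT.
have z_gen := g_iota_generates iotaM iota_inj.
have kerP := MDR_kernel_principal alpha z_gen.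
pose x0 := to_completion (VB_filtration R k N) (X0 k).
have fB x y : isoV (x - y) = isoV x - isoV y.
  by rewrite addrC -scaleN1r fP scaleN1r addrC.
have fX c : isoV (c * (x0 - 1)) = isoV c * (isoV x0 - 1) by rewrite fM fB f1.
have pB x y : p (x - y) = p x - p y.
  by rewrite addrC -scaleN1r [LHS]VB_hat_proj_linear scaleN1r addrC.
have p_ker x : p x = 0 <-> MDR_kernel k gT (isoV x).
  split=> [px|/kerP[c]]; last first.
    rewrite -fX0 -[c]f'K -fX => /(can_inj fK) ->; exact: VB_hat_proj_X0.
  (* isoV x is a limit of the elements isoV (c * (x0 - 1)) of the kernel. *)
  apply: MDR_kernel_closed => n.
  have [m _ mP] : nbhs x (isoV @^-1` [set y | coord y n = coord (isoV x) n])%classic.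
    by apply: fC; exists n.
  have [c cE] := VB_hat_proj_eq0_approx m px.
  exists (isoV (c * (x0 - 1))); first by apply/kerP; exists (isoV c); rewrite fX fX0.
  by apply/esym/mP; rewrite /mkset -cE.
have pp' x y : p x = p y <-> p' (isoV x) = p' (isoV y).
  have -> : p' (isoV x) = p' (isoV y) <-> MDR_kernel k gT (isoV x - isoV y).
    exact: lpiE.
  by rewrite -fB -p_ker pB; split=> [->|/subr0_eq //]; rewrite subrr.
have /choice[s sK] z : exists x, p x = z by apply: VB_hat_proj_surj.
pose isoM z := p' (isoV (s z)).
have isoME x : isoM (p x) = p' (isoV x) by apply/pp'; rewrite sK.
have /choice[t tK] w : exists y, p' y = w.
  by exists (repr (w : lquot (MDR_kernel k gT))); apply: lpiK.
pose isoM' w := p (f' (t w)).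
have isoME' y : isoM' (p' y) = p (f' y).
  by apply/pp'; rewrite !f'K tK.
exists isoM; split; last first.
  move=> g [_ _ gp]; apply: funext => z; rewrite -[z]sK isoME.
  by rewrite -[LHS]/((p' \o isoV) (s z)) -gp.
split; last by apply: funext => x; apply: isoME.
- move=> c z z'; rewrite -[z]sK -[z']sK -[in LHS]VB_hat_proj_linear !isoME.
  by rewrite fP; apply: (linearP (@MDR_proj k gT)).
split.
  apply/continuousP => U; rewrite MDR_openE => Uo.
  have -> : (isoM @^-1` U = p @` (isoV @^-1` (p' @^-1` U)))%classic.
    apply/seteqP; split=> [z Uz|_ [x Ux <-]] /=; last by rewrite isoME.
    by exists (s z).
  apply: completion_map_open; first exact: MB_filt_strict.
  by move/continuousP: fC; apply.
exists isoM'; split.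
- by move=> z; rewrite -[z]sK isoME isoME' fK.
- by move=> w; rewrite -[w]tK isoME' isoME f'K.
apply/continuousP => U Uo; rewrite MDR_openE.
have -> : (p' @^-1` (isoM' @^-1` U) = f' @^-1` (p @^-1` U))%classic.
  by apply/seteqP; split=> y /=; rewrite isoME'.
move/continuousP: f'C; apply.
have /continuousP := @completion_map_continuous _ _ _ _ _ _ (@MB_filt_proj R k N).
exact.
Qed.
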